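(* The following are equivalent over $\mathbf{RCA}_0$: (1) $\Pi^1_1$ comprehension. (2) For every sequence of CSC spaces $(X^j)_{j\in\mathbb{N}}$ the set $\{j\in\mathbb{N}: X^j\text{ is compact}\}$ exists.
   Context: All notions are formalized in second order arithmetic. CSC space: a tuple $(X,(U_i)_{i\in\mathbb{N}},k)$ with $X\subseteq\mathbb{N}$, $(U_i)$ a sequence of subsets of $X$ such that every $x\in X$ lies in some $U_i$, and $k:X\times\mathbb{N}\times\mathbb{N}\to\mathbb{N}$ a partial function such that $x\in U_i\cap U_j$ implies $x\in U_{k(x,i,j)}\subseteq U_i\cap U_j$. $X$ is compact if for every $I\subseteq\mathbb{N}$ with $X=\bigcup_{i\in I}U_i$ there is a finite $a\subseteq I$ with $X=\bigcup_{i\in a}U_i$. *)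

(* Defs.v *)
From mathcomp Require Import all_boot.

Set Implicit Arguments.
Unset Strict Implicit.
Unset Printing Implicit Defensive.

(* The two-sorted language L2 of second order arithmetic. Number variables and
   set variables are both named by natural numbers, in separate name spaces.
   As usual in L2, equality is primitive only between numbers. *)

Inductive term : Type :=
| Var of nat
| Zero
| One
| Add of term & term
| Mul of term & term.

Inductive formula : Type :=
| Eq of term & term
| Lt of term & term
| Mem of term & nat
| Not of formula
| And of formula & formula
| Or of formula & formula
| Imp of formula & formula
| All of nat & formula
| Ex of nat & formula
| AllS of nat & formula
| ExS of nat & formula.

Fixpoint occurs (x : nat) (t : term) : bool :=
  match t with
  | Var y => y == x
  | Zero | One => false
  | Add t1 t2 | Mul t1 t2 => occurs x t1 || occurs x t2
  end.

Inductive Sigma00 : formula -> Prop :=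
| Sigma00_Eq t1 t2 : Sigma00 (Eq t1 t2)
| Sigma00_Lt t1 t2 : Sigma00 (Lt t1 t2)
| Sigma00_Mem t X : Sigma00 (Mem t X)
| Sigma00_Not f : Sigma00 f -> Sigma00 (Not f)
| Sigma00_And f g : Sigma00 f -> Sigma00 g -> Sigma00 (And f g)
| Sigma00_Or f g : Sigma00 f -> Sigma00 g -> Sigma00 (Or f g)
| Sigma00_Imp f g : Sigma00 f -> Sigma00 g -> Sigma00 (Imp f g)
| Sigma00_All x t f :
    ~~ occurs x t -> Sigma00 f -> Sigma00 (All x (Imp (Lt (Var x) t) f))
| Sigma00_Ex x t f :
    ~~ occurs x t -> Sigma00 f -> Sigma00 (Ex x (And (Lt (Var x) t) f)).

Definition Sigma01 (f : formula) : Prop :=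
  exists x g, Sigma00 g /\ f = Ex x g.

Definition Pi01 (f : formula) : Prop :=
  exists x g, Sigma00 g /\ f = All x g.

(* Set variables may occur free in an arithmetical formula. *)
Fixpoint arithmetical (f : formula) : bool :=
  match f with
  | Eq _ _ | Lt _ _ | Mem _ _ => true
  | Not g | All _ g | Ex _ g => arithmetical g
  | And g h | Or g h | Imp g h => arithmetical g && arithmetical h
  | AllS _ _ | ExS _ _ => false
  end.

Definition Pi11 (f : formula) : Prop :=
  exists X g, arithmetical g /\ f = AllS X g.

(* Henkin structures: set quantifiers range over [sets], which need not
   represent every subset of [dom]. Both sorts are nonempty, as usual in
   first-order logic. *)
Record L2_structure : Type := L2Structure {
  dom : Type;
  sets : Type;
  zero : dom;
  one : dom;
  add : dom -> dom -> dom;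
  mul : dom -> dom -> dom;
  lt : dom -> dom -> Prop;
  mem : dom -> sets -> Prop;
  sets_inhabited : inhabited sets
}.

Arguments zero {_}.
Arguments one {_}.
Arguments add {_} _ _.
Arguments mul {_} _ _.
Arguments lt {_} _ _.
Arguments mem {_} _ _.

Definition update (A : Type) (v : nat -> A) (x : nat) (a : A) : nat -> A :=
  fun y => if y == x then a else v y.

Fixpoint eval (M : L2_structure) (v : nat -> dom M) (t : term) : dom M :=
  match t with
  | Var x => v x
  | Zero => zero
  | One => one
  | Add t1 t2 => add (eval v t1) (eval v t2)
  | Mul t1 t2 => mul (eval v t1) (eval v t2)
  end.

Fixpoint sat (M : L2_structure) (v : nat -> dom M) (s : nat -> sets M)
    (f : formula) : Prop :=
  match f with
  | Eq t1 t2 => eval v t1 = eval v t2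
  | Lt t1 t2 => lt (eval v t1) (eval v t2)
  | Mem t X => mem (eval v t) (s X)
  | Not g => ~ sat v s g
  | And g h => sat v s g /\ sat v s h
  | Or g h => sat v s g \/ sat v s h
  | Imp g h => sat v s g -> sat v s h
  | All x g => forall a, sat (update v x a) s g
  | Ex x g => exists a, sat (update v x a) s g
  | AllS X g => forall A, sat v (update s X A) g
  | ExS X g => exists A, sat v (update s X A) g
  end.

Definition set_exists (M : L2_structure) (P : dom M -> Prop) : Prop :=
  exists Z : sets M, forall n, mem n Z <-> P n.

(* In each scheme, the valuations [v] and [s] supply the number and set
   parameters, and [x] is the distinguished number variable. *)

Definition Delta01_comprehension (M : L2_structure) : Prop :=
  forall (f g : formula) (x : nat) (v : nat -> dom M) (s : nat -> sets M),
    Sigma01 f -> Pi01 g ->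
    (forall n, sat (update v x n) s f <-> sat (update v x n) s g) ->
    set_exists (fun n => sat (update v x n) s f).

Definition Sigma01_induction (M : L2_structure) : Prop :=
  forall (f : formula) (x : nat) (v : nat -> dom M) (s : nat -> sets M),
    Sigma01 f ->
    sat (update v x zero) s f ->
    (forall n, sat (update v x n) s f -> sat (update v x (add n one)) s f) ->
    forall n, sat (update v x n) s f.

Definition Pi11_comprehension (M : L2_structure) : Prop :=
  forall (f : formula) (x : nat) (v : nat -> dom M) (s : nat -> sets M),
    Pi11 f -> set_exists (fun n => sat (update v x n) s f).

Record basic_axioms (M : L2_structure) : Prop := BasicAxioms {
  succ_neq0 : forall n : dom M, add n one <> zero;
  succ_inj : forall m n : dom M, add m one = add n one -> m = n;
  add_zero : forall m : dom M, add m zero = m;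
  add_succ : forall m n : dom M, add m (add n one) = add (add m n) one;
  mul_zero : forall m : dom M, mul m zero = zero;
  mul_succ : forall m n : dom M, mul m (add n one) = add (mul m n) m;
  lt_zero : forall m : dom M, ~ lt m zero;
  lt_succ : forall m n : dom M, lt m (add n one) <-> lt m n \/ m = n
}.

Record RCA0 (M : L2_structure) : Prop := RCA0Model {
  RCA0_basic : basic_axioms M;
  RCA0_induction : Sigma01_induction M;
  RCA0_comprehension : Delta01_comprehension M
}.

(* From here on, everything is interpreted inside a structure [M]: numbers are
   elements of [dom M], and quantified sets are elements of [sets M]. The
   operations take arbitrary classes as arguments so that they apply to
   sections of sets of [M]. *)

Definition pair (M : L2_structure) (a b : dom M) : dom M :=
  add (mul (add a b) (add a b)) a.

Definition section (M : L2_structure) (S : dom M -> Prop) (i : dom M) :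
    dom M -> Prop :=
  fun n => S (pair i n).

Definition class_of (M : L2_structure) (Z : sets M) : dom M -> Prop :=
  fun n => mem n Z.

Definition finite (M : L2_structure) (a : sets M) : Prop :=
  exists b, forall i, mem i a -> lt i b.

Definition quadruple (M : L2_structure) (x i j m : dom M) : dom M :=
  pair (pair (pair x i) j) m.

(* [k] is the graph of a partial function from X * N * N to N. *)
Definition partial_function (M : L2_structure) (X k : dom M -> Prop) : Prop :=
  (forall z, k z -> exists x i j m, X x /\ z = quadruple x i j m) /\
  (forall x i j m m',
     k (quadruple x i j m) -> k (quadruple x i j m') -> m = m').

(* The basic open set U_i is [section U i]. *)
Record CSC_space (M : L2_structure) (X U k : dom M -> Prop) : Prop := CSCSpace {
  CSC_subset : forall i x, section U i x -> X x;
  CSC_cover : forall x, X x -> exists i, section U i x;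
  CSC_function : partial_function X k;
  CSC_base : forall x i j, section U i x -> section U j x ->
    exists m, [/\ k (quadruple x i j m), section U m x &
      forall y, section U m y -> section U i y /\ section U j y]
}.

Definition covers (M : L2_structure) (X U : dom M -> Prop) (I : sets M) : Prop :=
  forall x, X x <-> exists i, mem i I /\ section U i x.

Definition compact (M : L2_structure) (X U : dom M -> Prop) : Prop :=
  forall I : sets M, covers X U I ->
    exists a : sets M,
      [/\ finite a, forall i, mem i a -> mem i I & covers X U a].

(* A sequence of CSC spaces is given by sets X, U, k whose j-th sections form
   the j-th space. *)
Definition CSC_sequence (M : L2_structure) (X U k : sets M) : Prop :=
  forall j, CSC_space (section (class_of X) j) (section (class_of U) j)
    (section (class_of k) j).

Definition compact_indices_exist (M : L2_structure) : Prop :=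
  forall X U k : sets M, CSC_sequence X U k ->
    set_exists (fun j =>
      compact (section (class_of X) j) (section (class_of U) j)).

(* Main.v *)
(* Sets of numbers are produced from (2) in three steps.

   Arithmetical comprehension: for a set Z, the discrete space on
   {x : no m < x has (m, n) in Z} is finite, hence compact, iff some (m, n) is in Z;
   so (2) yields all projections of sets.

   A countable propositional theory with countably infinite clauses is satisfiable iff
   the tree of finite sequences of pairwise consistent literals, the m-th one chosen
   from the m-th clause, has an infinite path. Topologize the tree by the sets
   U_(s,b) of all extensions of s whose entry right after s, if any, is at least b.
   A path f gives the cover by the U_(s,b) with b = f(|s|)+1 for s on f and b = 0
   otherwise, in which an initial segment of f is covered only at itself. Conversely,
   if a cover has no finite subcover, then every s whose cone is not finitely covered
   has a child with the same property, and the leftmost sequence of such nodes is an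
   arithmetical path. So (2) decides satisfiability.

   Finally, the Tarski truth conditions of an arithmetical formula phi(n, A) are such a
   theory in the unknown A and the truth sets of the subformulas, so that
   {n : forall A, phi(n, A)} is the set of n for which the theory of not phi(n, A)
   is unsatisfiable.

   For the converse, compactness is a Pi^1_1 condition since finite subcovers can be
   replaced by initial parts of the cover. *)

From Stdlib Require Import Classical ClassicalEpsilon FunctionalExtensionality Ring.
From mathcomp Require Import all_boot.
Require Import Defs.

Set Implicit Arguments.
Unset Strict Implicit.
Unset Printing Implicit Defensive.

Ltac sigma00 := repeat first
  [ apply: Sigma00_Eq | apply: Sigma00_Lt | apply: Sigma00_Mem
  | apply: Sigma00_Not | apply: Sigma00_And | apply: Sigma00_Or
  | apply: Sigma00_Imp | apply: Sigma00_All | apply: Sigma00_Ex ]; try done.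

(** * Arithmetic in a model *)

Section Model.

Variable M : L2_structure.
Hypothesis hM : RCA0 M.

Local Notation D := (dom M).
Local Notation "0" := (@zero M).
Local Notation "1" := (@one M).
Local Infix "+" := (@add M).
Local Infix "*" := (@mul M).
Local Infix "<" := (@lt M).

Let B := RCA0_basic hM.

(** The induction formula is given by its matrix [g]: variable 0 is the induction variable, 1 and 2
    carry the parameters, 3 is the unbounded witness. Ranging over all valuations [u] frees callers
    from computing with [update]. *)
Lemma sigma01_ind (g : formula) (s : nat -> sets M) (c d : D) (P : D -> Prop) :
  Sigma00 g ->
  (forall n u, u 0%N = n -> u 1%N = c -> u 2 = d ->
     ((exists k, sat (update u 3 k) s g) <-> P n)) ->
  P 0 -> (forall n, P n -> P (n + 1)) -> forall n, P n.
Proof.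
move=> g0 gP P0 PS n.
pose v i := if i is 1%N then c else d.
have e m : sat (update v 0%N m) s (Ex 3 g) <-> P m by exact: gP.
apply/e; apply: (RCA0_induction hM); first by exists 3, g.
- exact/e.
- by move=> m /e /PS /e.
Qed.

Lemma some_sets : exists s : nat -> sets M, True.
Proof. by case: (sets_inhabited M) => Z; exists (fun=> Z). Qed.

Lemma delta0_ind (g : formula) (c d : D) (P : D -> Prop) :
  Sigma00 g ->
  (forall s n u, u 0%N = n -> u 1%N = c -> u 2 = d -> (sat u s g <-> P n)) ->
  P 0 -> (forall n, P n -> P (n + 1)) -> forall n, P n.
Proof.
move=> g0 gP; have [s _] := some_sets.
apply: (sigma01_ind (s := s) (c := c) (d := d) g0) => n u u0 u1 u2; split.
  by case=> k; rewrite (gP _ n).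
by move=> Pn; exists 0; rewrite (gP _ n).
Qed.

Lemma delta0_ind_eq (t1 t2 : term) (c d : D) (f1 f2 : D -> D) :
  (forall u, u 1%N = c -> u 2 = d -> eval u t1 = f1 (u 0%N) /\ eval u t2 = f2 (u 0%N)) ->
  f1 0 = f2 0 -> (forall n, f1 n = f2 n -> f1 (n + 1) = f2 (n + 1)) ->
  forall n, f1 n = f2 n.
Proof.
move=> h; apply: (delta0_ind (g := Eq t1 t2) (c := c) (d := d)); first by sigma00.
by move=> s n u <- u1 u2 /=; have [-> ->] := h u u1 u2.
Qed.

Local Notation "'x0" := (Var 0).
Local Notation "'x1" := (Var 1).
Local Notation "'x2" := (Var 2).
Local Notation "'x3" := (Var 3).

Lemma add0n n : 0 + n = n.
Proof.
move: n; apply: (@delta0_ind_eq (Add Zero 'x0) 'x0 0 0) => //=.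
- exact: (add_zero B).
- by move=> n e; rewrite (add_succ B) e.
Qed.

Lemma addSn m n : (m + 1) + n = (m + n) + 1.
Proof.
move: n; apply: (@delta0_ind_eq (Add (Add 'x1 One) 'x0) (Add (Add 'x1 'x0) One) m 0).
- by move=> u /= -> _.
- by rewrite !(add_zero B).
- by move=> n e; rewrite !(add_succ B) e.
Qed.

Lemma addC m n : m + n = n + m.
Proof.
move: n; apply: (@delta0_ind_eq (Add 'x1 'x0) (Add 'x0 'x1) m 0).
- by move=> u /= -> _.
- by rewrite (add_zero B) add0n.
- by move=> n e; rewrite (add_succ B) addSn e.
Qed.

Lemma addA m n p : m + (n + p) = (m + n) + p.
Proof.
move: p; apply: (@delta0_ind_eq (Add 'x1 (Add 'x2 'x0)) (Add (Add 'x1 'x2) 'x0) m n).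
- by move=> u /= -> ->.
- by rewrite !(add_zero B).
- by move=> p e; rewrite !(add_succ B) e.
Qed.

Lemma mul0n n : 0 * n = 0.
Proof.
move: n; apply: (@delta0_ind_eq (Mul Zero 'x0) Zero 0 0) => //=.
- exact: (mul_zero B).
- by move=> n e; rewrite (mul_succ B) e (add_zero B).
Qed.

Lemma mulSn m n : (m + 1) * n = m * n + n.
Proof.
move: n; apply: (@delta0_ind_eq (Mul (Add 'x1 One) 'x0) (Add (Mul 'x1 'x0) 'x0) m 0).
- by move=> u /= -> _.
- by rewrite !(mul_zero B) (add_zero B).
- move=> n e; rewrite !(mul_succ B) e !(add_succ B); congr (_ + 1).
  by rewrite -!addA [n + m]addC.
Qed.

Lemma mulC m n : m * n = n * m.
Proof.
move: n; apply: (@delta0_ind_eq (Mul 'x1 'x0) (Mul 'x0 'x1) m 0).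
- by move=> u /= -> _.
- by rewrite (mul_zero B) mul0n.
- by move=> n e; rewrite (mul_succ B) mulSn e.
Qed.

Lemma mulDl m n p : (m + n) * p = m * p + n * p.
Proof.
move: p; apply: (@delta0_ind_eq (Mul (Add 'x1 'x2) 'x0) (Add (Mul 'x1 'x0) (Mul 'x2 'x0)) m n).
- by move=> u /= -> ->.
- by rewrite !(mul_zero B) (add_zero B).
- move=> p e; rewrite !(mul_succ B) e -!addA; congr (_ + _).
  by rewrite !addA [n * p + m]addC.
Qed.

Lemma mulA m n p : m * (n * p) = (m * n) * p.
Proof.
move: p; apply: (@delta0_ind_eq (Mul 'x1 (Mul 'x2 'x0)) (Mul (Mul 'x1 'x2) 'x0) m n).
- by move=> u /= -> ->.
- by rewrite !(mul_zero B).
- by move=> p e; rewrite !(mul_succ B) mulC mulDl -[n * p * m]mulC e [n * m]mulC.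
Qed.

Lemma mul1n n : 1 * n = n.
Proof. by rewrite -[1]add0n mulSn mul0n add0n. Qed.

Lemma semiring_dom : semi_ring_theory 0 1 (@add M) (@mul M) (@eq D).
Proof.
split; [exact: add0n | exact: addC | exact: addA | exact: mul1n | exact: mul0n
  | exact: mulC | exact: mulA | exact: mulDl].
Qed.

Add Ring dom_ring : semiring_dom.

Lemma addnI p m n : m + p = n + p -> m = n.
Proof.
move: p; apply: (@delta0_ind (Imp (Eq (Add 'x1 'x0) (Add 'x2 'x0)) (Eq 'x1 'x2)) m n).
- by sigma00.
- by move=> s p u /= -> -> ->.
- by rewrite !(add_zero B).
- by move=> p IH; rewrite !(add_succ B) => /(succ_inj B).
Qed.

Lemma zero_or_succ n : n = 0 \/ exists m, n = m + 1.
Proof.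
have [s _] := some_sets; move: n.
apply: (@sigma01_ind (Or (Eq 'x0 Zero) (Eq 'x0 (Add 'x3 One))) s 0 0).
- by sigma00.
- move=> n u /= <- _ _; split; first by case=> k []; [left | right; exists k].
  by case=> [e|[m e]]; [exists 0; left | exists m; right].
- by left.
- by move=> n _; right; exists n.
Qed.

(** * The order and its relation to addition *)

Definition le (a b : D) := exists k, b = a + k.
Local Infix "<=" := le.

Lemma le_total m n : m <= n \/ n <= m.
Proof.
have [s _] := some_sets; move: n.
apply: (@sigma01_ind (Or (Eq 'x0 (Add 'x1 'x3)) (Eq 'x1 (Add 'x0 'x3))) s m 0).
- by sigma00.
- move=> n u /= <- <- _; split.
    by case=> k []; [left | right]; exists k.
  by case=> -[k e]; exists k; [left | right].
- by right; exists m; ring.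
- move=> n [[k ->]|[k ->]]; first by left; exists (k + 1); ring.
  case: (zero_or_succ k) => [->|[j ->]]; first by left; exists 1; ring.
  by right; exists j; ring.
Qed.

Lemma ltP a b : a < b <-> exists k, b = a + k + 1.
Proof.
split.
  have [s _] := some_sets; move: b.
  (* Moving the existential quantifier in front of the implication makes the formula Sigma^0_1; if
     [a < b] fails, any witness, such as 0, will do. *)
  apply: (@sigma01_ind (Imp (Lt 'x1 'x0) (Eq 'x0 (Add (Add 'x1 'x3) One))) s a 0).
  - by sigma00.
  - move=> n u /= <- <- _; split; first by case=> k h /h; exists k.
    move=> h; case: (classic (u 1%N < u 0%N)) => [/h [k e]|h']; first by exists k.
    by exists 0.
  - by move=> /(lt_zero B).
  - move=> n IH /(lt_succ B) [/IH [k ->]|->]; first by exists (k + 1); ring.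
    by exists 0; ring.
case=> k ->; move: k.
apply: (@delta0_ind (Lt 'x1 (Add (Add 'x1 'x0) One)) a 0).
- by sigma00.
- by move=> s n u /= -> -> _.
- by apply/(lt_succ B); right; ring.
- move=> n IH; apply/(lt_succ B); left.
  by rewrite addA.
Qed.

Lemma leS a b : a < b + 1 <-> a <= b.
Proof.
rewrite ltP; split=> -[k]; last by move=> ->; exists k.
by move=> /(succ_inj B) ->; exists k.
Qed.

Lemma ltS a b : a + 1 <= b <-> a < b.
Proof. by rewrite ltP; split=> -[k ->]; exists k; ring. Qed.

Lemma le_refl a : a <= a.
Proof. by exists 0; ring. Qed.

Lemma le_0 a : 0 <= a.
Proof. by exists a; ring. Qed.

Lemma le_trans b a c : a <= b -> b <= c -> a <= c.
Proof. by move=> [k ->] [l ->]; exists (k + l); ring. Qed.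

Lemma lt_le_trans b a c : a < b -> b <= c -> a < c.
Proof. by rewrite -!ltS; apply: le_trans. Qed.

Lemma ltW a b : a < b -> a <= b.
Proof. by move=> /ltP [k ->]; exists (k + 1); ring. Qed.

Lemma le_lt_trans b a c : a <= b -> b < c -> a < c.
Proof. by move=> [k ->] /ltP [l ->]; apply/ltP; exists (k + l); ring. Qed.

Lemma lt_trans b a c : a < b -> b < c -> a < c.
Proof. by move=> /ltW; apply: le_lt_trans. Qed.

Lemma lt_irr a : ~ a < a.
Proof.
move=> /ltP [k e]; have : k + 1 = 0 by apply: (@addnI a); rewrite {2}e; ring.
exact: (succ_neq0 B).
Qed.

Lemma le_nlt a b : a <= b -> ~ b < a.
Proof. by move=> h /(le_lt_trans h) /lt_irr. Qed.

Lemma lt_succ_diag a : a < a + 1.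
Proof. exact/leS/le_refl. Qed.

Lemma le_lt a b : a <= b \/ b < a.
Proof.
case: (le_total a b) => [|[k ->]]; first by left.
case: (zero_or_succ k) => [->|[j ->]]; first by left; exists 0; ring.
by right; apply/ltP; exists j; ring.
Qed.

Lemma nlt_le a b : ~ a < b -> b <= a.
Proof. by case: (le_lt b a). Qed.

Lemma le_anti a b : a <= b -> b <= a -> a = b.
Proof.
move=> [k ->] [l e]; case: (zero_or_succ k) => [->|[j ej]]; first by ring.
case: (@lt_irr a); apply/ltP; exists (j + l).
by rewrite {1}e ej; ring.
Qed.

Lemma le_lteq a b : a <= b -> a < b \/ a = b.
Proof. by move=> /leS /(lt_succ B). Qed.

Lemma lt_tri a b : [\/ a < b, a = b | b < a].
Proof.
case: (le_lt a b) => [/le_lteq [h|h]|h];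
  [exact: Or31 | exact: Or32 | exact: Or33].
Qed.

Lemma le_addr a b : a <= a + b.
Proof. by exists b. Qed.

Lemma le_addl a b : a <= b + a.
Proof. by exists b; ring. Qed.

Lemma le_sqr a : a <= a * a.
Proof.
case: (zero_or_succ a) => [->|[k ->]]; first exact: le_0.
by exists (k * (k + 1)); ring.
Qed.

(** * The pairing function *)

Lemma le_pairl (a b : D) : a <= pair a b.
Proof. exact: le_addl. Qed.

Lemma le_pairr (a b : D) : b <= pair a b.
Proof.
apply: (le_trans (le_addl b a)); apply: (le_trans (le_sqr _)); exact: le_addr.
Qed.

(** With n = a + b the code is n^2 + a, which lies between n^2 and n^2 + n, hence below (n +
    1)^2. *)
Lemma pair_lt (a b c d : D) : a + b < c + d -> pair a b < pair c d.
Proof.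
move=> /ltP [k e]; rewrite /pair e; apply/ltP.
exists (a + b + b + (1 + 1) * (a + b) * k + k * k + (1+1) * k + c); ring.
Qed.

Lemma pair_inj (a b c d : D) : pair a b = pair c d -> a = c /\ b = d.
Proof.
move=> e; case: (lt_tri (a + b) (c + d)) => h.
- by move: (pair_lt h); rewrite e => /lt_irr.
- have ac : a = c by move: e; rewrite /pair h addC [_ + c]addC => /addnI.
  by split=> //; apply: (@addnI c); rewrite -{1}ac addC h addC.
- by move: (pair_lt h); rewrite e => /lt_irr.
Qed.

(* On numbers that are not pairs, [fst] and [snd] below are both 0. *)
Definition is_unpair (z a b : D) :=
  z = pair a b \/ ((a = 0 /\ b = 0) /\ forall c d, z <> pair c d).

Lemma unpair_ex z : exists ab : D * D, is_unpair z ab.1 ab.2.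
Proof.
case: (classic (exists c d, z = pair c d)) => [[c [d e]]|h].
  by exists (c, d); left.
by exists (0, 0); right; split=> // c d e; apply: h; exists c, d.
Qed.

Definition unpair z := proj1_sig (constructive_indefinite_description _ (unpair_ex z)).
Definition fst z := (unpair z).1.
Definition snd z := (unpair z).2.

(** The values of [fst] and [snd] are chosen outside the model; this equivalence lets formulas speak
    of them through [is_unpair], whose quantifiers can be bounded by [z]. *)
Lemma unpairP z a b : is_unpair z a b <-> a = fst z /\ b = snd z.
Proof.
rewrite /fst /snd /unpair; case: constructive_indefinite_description => -[c d] /= h.
split; last by case=> -> ->.
case: h => [->|[[-> ->] h]] [e|[[-> ->] h']]; last by [].
- by have [-> ->] := pair_inj e.
- by case: (h' c d).
- by case: (h a b).
Qed.

Lemma fst_pair (a b : D) : fst (pair a b) = a.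
Proof. by have [] : a = fst (pair a b) /\ b = snd (pair a b) by apply/unpairP; left. Qed.

Lemma snd_pair (a b : D) : snd (pair a b) = b.
Proof. by have [] : a = fst (pair a b) /\ b = snd (pair a b) by apply/unpairP; left. Qed.

Lemma unpair_le z : fst z <= z /\ snd z <= z.
Proof.
case: (unpair_ex z) => -[a b] /= h; have [<- <-] := (unpairP z a b).1 h.
case: h => [->|[[-> ->] _]]; first by split; [exact: le_pairl | exact: le_pairr].
by split; exact: le_0.
Qed.

(** * Comprehension *)

Definition pairT (t1 t2 : term) := Add (Mul (Add t1 t2) (Add t1 t2)) t1.

(** Variable 5 is the element and 6 the parameter. A dummy quantifier over variable 19 turns [g]
    into a Sigma^0_1 formula and an equivalent Pi^0_1 formula. *)
Lemma delta0_comp (g : formula) (s : nat -> sets M) (c : D) (Q : D -> Prop) :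
  Sigma00 g ->
  (forall p u, u 5 = p -> u 6 = c -> (sat u s g <-> Q p)) ->
  set_exists Q.
Proof.
move=> g0 gQ; pose v (_ : nat) := c.
have ext n k : sat (update (update v 5 n) 19 k) s g <-> Q n by exact: gQ.
have [|||Z ZP] := RCA0_comprehension hM (f := Ex 19 g) (g := All 19 g) (x := 5) (v := v) (s := s).
- by exists 19, g.
- by exists 19, g.
- move=> n /=; split; first by case=> k /ext q l; apply/ext.
  by move=> h; exists 0; apply/ext/(ext _ 0).
exists Z => n; rewrite ZP /=; split; first by case=> k /ext.
by move=> /ext q; exists 0.
Qed.

(** Evaluates [g] with variables [a] and [b] set to the two components of variable [z], using
    bounded quantifiers only. Variables 17 and 18 are scratch, hence the side conditions in
    [sat_unpairF]. *)
Definition unpairF (z a b : nat) (g : formula) :=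
  let isp :=
    Or (Eq (Var z) (pairT (Var a) (Var b)))
       (And (And (Eq (Var a) Zero) (Eq (Var b) Zero))
          (All 17 (Imp (Lt (Var 17) (Add (Var z) One))
          (All 18 (Imp (Lt (Var 18) (Add (Var z) One))
             (Not (Eq (Var z) (pairT (Var 17) (Var 18))))))))) in
  Ex a (And (Lt (Var a) (Add (Var z) One))
  (Ex b (And (Lt (Var b) (Add (Var z) One)) (And isp g)))).

Lemma sat_unpairF z a b g u s :
  (z < 17)%N -> (a < 17)%N -> (b < 17)%N -> z != a -> z != b -> a != b ->
  sat u s (unpairF z a b g) <->
  sat (update (update u a (fst (u z))) b (snd (u z))) s g.
Proof.
move=> z7 a7 b7 za zb ab.
have E x y : (u z = pair x y \/ (x = 0 /\ y = 0) /\
    (forall c, c < u z + 1 -> forall d, d < u z + 1 -> u z <> pair c d))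
    <-> x = fst (u z) /\ y = snd (u z).
  apply: (iff_trans _ (unpairP (u z) x y)); split=> -[h|[h1 h2]].
  - by left.
  - right; split=> // c d e; apply: (h2 c _ d _ e); apply/leS; rewrite e.
      exact: le_pairl.
    exact: le_pairr.
  - by left.
  - by right; split=> // c _ d _; apply: h2.
have z17 := ltn_eqF z7; have a17 := ltn_eqF a7; have b17 := ltn_eqF b7.
have z18 : (z == 18) = false by rewrite ltn_eqF // (ltn_trans z7).
have a18 : (a == 18) = false by rewrite ltn_eqF // (ltn_trans a7).
have b18 : (b == 18) = false by rewrite ltn_eqF // (ltn_trans b7).
rewrite /= /update !eqxx (negbTE za) (negbTE zb) (negbTE ab).
rewrite ?z17 ?z18 ?a17 ?a18 ?b17 ?b18.
split.
  by case=> x [_ [y [_ [/E [-> ->]]]]].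
move=> h; have [h1 h2] := unpair_le (u z).
exists (fst (u z)); split; first exact/leS.
exists (snd (u z)); split; first exact/leS.
by split=> //; apply/E.
Qed.

Lemma Sigma00_unpairF z a b g :
  z != a -> z != b -> (z < 17)%N -> Sigma00 g -> Sigma00 (unpairF z a b g).
Proof.
move=> za zb z7 g0.
have L7 : (z == 17) = false by rewrite ltn_eqF.
have L8 : (z == 18) = false by rewrite ltn_eqF // (ltn_trans z7).
by rewrite /unpairF; sigma00; rewrite /= ?orbF ?L7 ?L8 ?za ?zb.
Qed.

Lemma delta0_stack_comp (g : formula) (s : nat -> sets M) (c : D) (Q : D -> Prop) :
  Sigma00 g ->
  (forall p u, u 0%N = fst p -> u 1%N = fst (snd p) -> u 2 = fst (snd (snd p)) ->
     u 3 = snd p -> u 4 = snd (snd p) -> u 5 = p -> u 6 = c ->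
     (sat u s g <-> Q p)) ->
  set_exists Q.
Proof.
move=> g0 gQ.
apply: (@delta0_comp (unpairF 5 0 3 (unpairF 3 1 4 (unpairF 4 2 7 g))) s c).
  by do 3 apply: Sigma00_unpairF => //.
move=> p u u5 u6; rewrite !sat_unpairF //.
by apply: gQ; rewrite /update /= ?u5.
Qed.

(** * Arithmetical comprehension from the set of compact indices *)

Hypothesis hC : compact_indices_exist M.

Local Notation "x \in Z" := (mem x Z).
Local Notation "x \notin Z" := (~ mem x Z).

Lemma restrict_ex (Z : sets M) b : exists a : sets M, forall i, i \in a <-> i \in Z /\ i < b.
Proof.
apply: (@delta0_comp (And (Mem (Var 5) 0) (Lt (Var 5) (Var 6))) (fun=> Z) b).
  by sigma00.
by move=> p u /= -> ->.
Qed.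

(* The n-th space is discrete on {x : no m < x with (m, n) in Z}, hence compact iff finite. *)
Lemma projection (Z : sets M) : set_exists (fun n => exists m, pair m n \in Z).
Proof.
have [X XP] : set_exists (fun p => p = pair (fst p) (snd p) /\
    forall m, m < snd p -> pair m (fst p) \notin Z).
  apply: (@delta0_stack_comp (And (Eq (Var 5) (pairT (Var 0) (Var 3)))
    (All 7 (Imp (Lt (Var 7) (Var 3)) (Not (Mem (pairT (Var 7) (Var 0)) 0))))) (fun=> Z) 0).
    by sigma00.
  by move=> p u; rewrite /= /update /= => -> _ _ -> _ -> _; apply: iff_refl.
have {}XP n x : pair n x \in X <-> forall m, m < x -> pair m n \notin Z.
  by rewrite XP fst_pair snd_pair; split=> // -[].
have [U UP] : set_exists (fun p => p = pair (fst p) (pair (snd (snd p)) (snd (snd p))) /\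
    pair (fst p) (snd (snd p)) \in X).
  apply: (@delta0_stack_comp (And (Eq (Var 5) (pairT (Var 0) (pairT (Var 4) (Var 4))))
    (Mem (pairT (Var 0) (Var 4)) 0)) (fun=> X) 0).
    by sigma00.
  by move=> p u /= -> _ _ _ -> -> _; apply: iff_refl.
have {}UP n i x : pair n (pair i x) \in U <-> i = x /\ pair n x \in X.
  rewrite UP !fst_pair !snd_pair; split.
    by case=> /pair_inj [_ /pair_inj []].
  by case=> ->.
have [k kP] : set_exists (fun p => let x := snd (snd p) in
    p = pair (fst p) (quadruple x x x x) /\ pair (fst p) x \in X).
  apply: (@delta0_stack_comp (And (Eq (Var 5) (pairT (Var 0)
    (pairT (pairT (pairT (Var 4) (Var 4)) (Var 4)) (Var 4))))
    (Mem (pairT (Var 0) (Var 4)) 0)) (fun=> X) 0).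
    by sigma00.
  by move=> p u /= -> _ _ _ -> -> _; apply: iff_refl.
have {}kP n q : pair n q \in k <-> exists x, q = quadruple x x x x /\ pair n x \in X.
  rewrite kP; split; last by case=> x [-> h]; rewrite !snd_pair fst_pair.
  rewrite fst_pair; case=> e h; exists (snd (snd (pair n q))); split=> //.
  by have [] := pair_inj e.
have [Y YP] : set_exists (fun n => compact (section (class_of X) n) (section (class_of U) n)).
  apply: (hC (k := k)) => n; rewrite /section /class_of; split.
  - by move=> i x /UP [_].
  - by move=> x Xx; exists x; apply/UP.
  - split=> [z /kP [x [-> h]]|x i j m m' /kP [y [e _]] /kP [y' [e' _]]].
      by exists x, x, x, x.
    by move: e e' => /pair_inj [/pair_inj [_ ->] ->] /pair_inj [/pair_inj [_ ->] ->].
  - move=> x i j /UP [-> h] /UP [-> _]; exists x; split.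
    + by apply/kP; exists x.
    + exact/UP.
    + by move=> y /UP [-> h']; split; apply/UP.
exists Y => n; rewrite YP /compact /covers /section /class_of; split.
  (* Otherwise the n-th space is all of N, and a part of the cover by all singletons with indices
     below [b] misses the point [b]. *)
  move=> h; apply: NNPP => no.
  have Xall x : pair n x \in X by apply/XP => m _ h'; apply: no; exists m.
  have [N NP] : set_exists (fun _ : D => True).
    apply: (@delta0_comp (Eq Zero Zero) (fun=> Z) 0); first by sigma00.
    by move=> p u.
  have [|a [[b bP] _ aU]] := h N.
    by move=> x; split=> // _; exists x; split; [apply/NP | apply/UP].
  have [i [ia /UP [e _]]] := (aU b).1 (Xall b).
  by apply: (@lt_irr b); rewrite -{1}e; apply: bP.
(* The witness [m] keeps all points at or below [m]; the index of a singleton is its point, so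
   indices below [m + 1] suffice. *)
case=> m hm I cI.
have [a aP] := restrict_ex I (m + 1).
exists a; split; first by exists (m + 1) => i /aP [].
  by move=> i /aP [].
move=> x; split; last by case=> i [/aP [iI _] h]; apply/cI; exists i.
move=> Xx; have [i [iI h]] := (cI x).1 Xx; exists i; split=> //; apply/aP; split=> //.
have [-> _] := (UP _ _ _).1 h; apply/leS/nlt_le => lt.
exact: ((XP _ _).1 Xx _ lt hm).
Qed.

(* An element [e] codes the stack [fst e, fst (snd e), ...]; [Ar] is the class of
   predicates on stacks that correspond to sets of [M]. *)
Fixpoint dec (e : D) (i : nat) : D :=
  if i is j.+1 then dec (snd e) j else fst e.

Definition Ar (P : (nat -> D) -> Prop) := set_exists (fun e => P (dec e)).

Definition Fn (t : (nat -> D) -> D) := Ar (fun w => w 0%N = t (fun i => w i.+1)).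

Lemma Ar_iff P Q : (forall v, P v <-> Q v) -> Ar P -> Ar Q.
Proof. by move=> h [Z ZP]; exists Z => e; rewrite ZP. Qed.

Lemma Ar_not P : Ar P -> Ar (fun v => ~ P v).
Proof.
case=> Z ZP; apply: (@delta0_comp (Not (Mem (Var 5) 0)) (fun=> Z) 0); first by sigma00.
by move=> p u /= -> _; rewrite ZP.
Qed.

Lemma Ar_or P Q : Ar P -> Ar Q -> Ar (fun v => P v \/ Q v).
Proof.
case=> Z ZP [Y YP].
apply: (@delta0_comp (Or (Mem (Var 5) 0) (Mem (Var 5) 1)) (fun i => if i is 0%N then Z else Y) 0).
  by sigma00.
by move=> p u /= -> _; rewrite ZP YP.
Qed.

Lemma Ar_and P Q : Ar P -> Ar Q -> Ar (fun v => P v /\ Q v).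
Proof.
move=> hP hQ; apply: (Ar_iff _ (Ar_not (Ar_or (Ar_not hP) (Ar_not hQ)))) => v; tauto.
Qed.

Lemma Ar_imp P Q : Ar P -> Ar Q -> Ar (fun v => P v -> Q v).
Proof. move=> hP hQ; apply: (Ar_iff _ (Ar_or (Ar_not hP) hQ)) => v; tauto. Qed.

Lemma Ar_equiv P Q : Ar P -> Ar Q -> Ar (fun v => P v <-> Q v).
Proof. by move=> hP hQ; apply: Ar_and; apply: Ar_imp. Qed.

(** The bound element is pushed on the stack, so the quantifier becomes the projection of a set of
    the model. *)
Lemma Ar_ex (Q : D -> (nat -> D) -> Prop) :
  Ar (fun w => Q (w 0%N) (fun i => w i.+1)) -> Ar (fun v => exists a, Q a v).
Proof.
case=> Z ZP; have [Y YP] := projection Z; exists Y => e; rewrite YP.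
by split=> -[a h]; exists a; move: h; rewrite ZP /= fst_pair snd_pair.
Qed.

Lemma Ar_all (Q : D -> (nat -> D) -> Prop) :
  Ar (fun w => Q (w 0%N) (fun i => w i.+1)) -> Ar (fun v => forall a, Q a v).
Proof.
move=> /Ar_not /(@Ar_ex (fun a v => ~ Q a v)) /Ar_not; apply: Ar_iff => v; split.
  by move=> h a; apply: NNPP => h'; apply: h; exists a.
by move=> h [a]; apply.
Qed.

Lemma Fn_shift t : Fn t -> Fn (fun w => t (fun i => w i.+1)).
Proof.
case=> Z ZP; apply: (@delta0_stack_comp (Mem (pairT (Var 0) (Var 4)) 0) (fun=> Z) 0).
  by sigma00.
move=> p u /= -> _ _ _ -> _ _; rewrite -[add _ _]/(pair _ _) ZP /=.
by rewrite fst_pair snd_pair.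
Qed.

(** Substitution is expressed by a quantifier over the value: some [a] equals [t v] and satisfies
    [Q a v]. *)
Lemma Ar_subst (Q : D -> (nat -> D) -> Prop) t :
  Fn t -> Ar (fun w => Q (w 0%N) (fun i => w i.+1)) -> Ar (fun v => Q (t v) v).
Proof.
move=> ht hQ; have := @Ar_ex (fun a v => a = t v /\ Q a v).
move=> /(_ (Ar_and ht hQ)); apply: Ar_iff => v; split; first by case=> a [->].
by move=> h; exists (t v).
Qed.

Lemma Ar_base (g : formula) (s : nat -> sets M) (c : D) (P : (nat -> D) -> Prop) :
  Sigma00 g ->
  (forall e u, u 0%N = dec e 0%N -> u 1%N = dec e 1%N -> u 2 = dec e 2 -> u 6 = c ->
     (sat u s g <-> P (dec e))) ->
  Ar P.
Proof. by move=> g0 gP; apply: (delta0_stack_comp (s := s) (c := c) g0) => *; apply: gP. Qed.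

Lemma Ar_rel1 (R : D -> Prop) t :
  Ar (fun w => R (w 0%N)) -> Fn t -> Ar (fun v => R (t v)).
Proof. by move=> hR ht; apply: (@Ar_subst (fun a v => R a)). Qed.

Lemma Ar_rel2 (R : D -> D -> Prop) t1 t2 :
  Ar (fun w => R (w 0%N) (w 1%N)) -> Fn t1 -> Fn t2 -> Ar (fun v => R (t1 v) (t2 v)).
Proof.
move=> hR ht1 ht2; apply: (@Ar_subst (fun a v => R (t1 v) a)) => //=.
by apply: (@Ar_subst (fun a w => R a (w 0%N))); first exact: Fn_shift.
Qed.

Lemma Ar_rel3 (R : D -> D -> D -> Prop) t1 t2 t3 :
  Ar (fun w => R (w 0%N) (w 1%N) (w 2)) -> Fn t1 -> Fn t2 -> Fn t3 ->
  Ar (fun v => R (t1 v) (t2 v) (t3 v)).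
Proof.
move=> hR ht1 ht2 ht3; apply: (@Ar_subst (fun a v => R (t1 v) (t2 v) a)) => //=.
apply: (@Ar_subst (fun a w => R (t1 (fun i => w i.+1)) a (w 0%N))); first exact: Fn_shift.
apply: (@Ar_subst (fun a w => R a (w 0%N) (w 1%N))) => //.
exact: (Fn_shift (Fn_shift ht1)).
Qed.

Lemma Fn_op1 (h : D -> D) t :
  Ar (fun w => w 1%N = h (w 0%N)) -> Fn t -> Fn (fun v => h (t v)).
Proof. by move=> hh ht; apply: (@Ar_subst (fun a w => w 0%N = h a)); first exact: Fn_shift. Qed.

Lemma Fn_op2 (h : D -> D -> D) t1 t2 :
  Ar (fun w => w 2 = h (w 0%N) (w 1%N)) -> Fn t1 -> Fn t2 -> Fn (fun v => h (t1 v) (t2 v)).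
Proof.
move=> hh ht1 ht2.
apply: (@Ar_subst (fun b w => w 0%N = h (t1 (fun i => w i.+1)) b)); first exact: Fn_shift.
apply: (@Ar_subst (fun a w => w 1%N = h a (w 0%N))) => //.
exact: (Fn_shift (Fn_shift ht1)).
Qed.

Lemma Fn_var i : Fn (fun v => v i).
Proof.
have [s _] := some_sets; elim: i => [|i IH]; last exact: (Fn_shift IH).
apply: (@Ar_base (Eq (Var 0) (Var 1)) s 0); first by sigma00.
by move=> e u /= -> -> _ _.
Qed.

Lemma Fn_const c : Fn (fun=> c).
Proof.
have [s _] := some_sets.
apply: (@Ar_base (Eq (Var 0) (Var 6)) s c); first by sigma00.
by move=> e u /= -> _ _ ->.
Qed.

Lemma Fn_add t1 t2 : Fn t1 -> Fn t2 -> Fn (fun v => t1 v + t2 v).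
Proof.
have [s _] := some_sets; apply: Fn_op2.
apply: (@Ar_base (Eq (Var 2) (Add (Var 0) (Var 1))) s 0); first by sigma00.
by move=> e u /= -> -> -> _.
Qed.

Lemma Fn_mul t1 t2 : Fn t1 -> Fn t2 -> Fn (fun v => t1 v * t2 v).
Proof.
have [s _] := some_sets; apply: Fn_op2.
apply: (@Ar_base (Eq (Var 2) (Mul (Var 0) (Var 1))) s 0); first by sigma00.
by move=> e u /= -> -> -> _.
Qed.

Lemma Fn_pair t1 t2 : Fn t1 -> Fn t2 -> Fn (fun v => pair (t1 v) (t2 v)).
Proof. by move=> h1 h2; do ?[apply: Fn_add | apply: Fn_mul]. Qed.

Lemma Ar_eq t1 t2 : Fn t1 -> Fn t2 -> Ar (fun v => t1 v = t2 v).
Proof.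
have [s _] := some_sets; apply: (Ar_rel2 (R := fun a b => a = b)).
apply: (@Ar_base (Eq (Var 0) (Var 1)) s 0); first by sigma00.
by move=> e u /= -> -> _ _.
Qed.

Lemma Ar_lt t1 t2 : Fn t1 -> Fn t2 -> Ar (fun v => t1 v < t2 v).
Proof.
have [s _] := some_sets; apply: Ar_rel2.
apply: (@Ar_base (Lt (Var 0) (Var 1)) s 0); first by sigma00.
by move=> e u /= -> -> _ _.
Qed.

Lemma Ar_mem t Z : Fn t -> Ar (fun v => t v \in Z).
Proof.
apply: (Ar_rel1 (R := fun a => a \in Z)).
apply: (@Ar_base (Mem (Var 0) 0) (fun=> Z) 0); first by sigma00.
by move=> e u /= -> _ _ _.
Qed.

Lemma Ar_le t1 t2 : Fn t1 -> Fn t2 -> Ar (fun v => t1 v <= t2 v).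
Proof.
move=> h1 h2; apply: (Ar_iff _ (Ar_not (Ar_lt h2 h1))) => v.
by split; [apply: nlt_le | apply: le_nlt].
Qed.

Lemma Ar_True : Ar (fun=> True).
Proof. by apply: (Ar_iff _ (Ar_eq (Fn_const 0) (Fn_const 0))). Qed.

(* [ar] proves [Ar] and [Fn] goals by following the syntax of the predicate; the hooks
   are redefined once the corresponding closure lemma is available. *)
Ltac ar_step := lazymatch goal with
  | |- Ar (fun _ => _ /\ _) => apply Ar_and
  | |- Ar (fun _ => _ \/ _) => apply Ar_or
  | |- Ar (fun _ => _ <-> _) => apply Ar_equiv
  | |- Ar (fun _ => ~ _) => apply Ar_not
  | |- Ar (fun _ => ex _) => apply Ar_ex
  | |- Ar (fun _ => _ = _) => apply Ar_eq
  | |- Ar (fun _ => lt _ _) => apply Ar_lt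
  | |- Ar (fun _ => le _ _) => apply Ar_le
  | |- Ar (fun _ => mem _ _) => apply Ar_mem
  | |- Ar (fun _ => True) => apply Ar_True
  | |- Ar (fun _ => forall _, _) => first [apply Ar_imp | apply Ar_all]
  | |- Fn (fun v => v _) => apply Fn_var
  | |- Fn (fun _ => pair _ _) => apply Fn_pair
  | |- Fn (fun _ => add _ _) => apply Fn_add
  | |- Fn (fun _ => mul _ _) => apply Fn_mul
  end.
Ltac ar_unpair := fail.
Ltac ar_finite := fail.
Ltac ar_tree := fail.
Ltac ar_bas := fail.
Ltac ar := cbn beta; repeat first
  [ assumption | progress (ar_step; cbn beta)
  | ar_unpair | ar_finite | ar_tree | ar_bas | apply Fn_const ].

Lemma Fn_fst t : Fn t -> Fn (fun v => fst (t v)).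
Proof.
apply: Fn_op1.
have : Ar (fun w => (exists b, w 0%N = pair (w 1%N) b) \/
    (w 1%N = 0 /\ forall c d, w 0%N <> pair c d)) by ar.
apply: Ar_iff => w; split.
  case=> [[b ->]|[-> h]]; first by rewrite fst_pair.
  by have [] : 0 = fst (w 0%N) /\ 0 = snd (w 0%N) by apply/unpairP; right.
move=> e; have : is_unpair (w 0%N) (w 1%N) (snd (w 0%N)) by apply/unpairP.
by case=> [h|[[h _] h']]; [left; exists (snd (w 0%N)) | right].
Qed.

Lemma Fn_snd t : Fn t -> Fn (fun v => snd (t v)).
Proof.
apply: Fn_op1.
have : Ar (fun w => (exists a, w 0%N = pair a (w 1%N)) \/
    (w 1%N = 0 /\ forall c d, w 0%N <> pair c d)) by ar.
apply: Ar_iff => w; split.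
  case=> [[b ->]|[-> h]]; first by rewrite snd_pair.
  by have [] : 0 = fst (w 0%N) /\ 0 = snd (w 0%N) by apply/unpairP; right.
move=> e; have : is_unpair (w 0%N) (fst (w 0%N)) (w 1%N) by apply/unpairP.
by case=> [h|[[_ h] h']]; [left; exists (fst (w 0%N)) | right].
Qed.

Ltac ar_unpair ::= lazymatch goal with
  | |- Fn (fun _ => fst _) => apply Fn_fst
  | |- Fn (fun _ => snd _) => apply Fn_snd
  end.

(** The number n is represented by the stack [pair n 0], whose top entry is n. *)
Lemma comprehension (P : D -> Prop) : Ar (fun w => P (w 0%N)) -> set_exists P.
Proof.
case=> Z ZP.
apply: (@delta0_comp (Mem (pairT (Var 5) Zero) 0) (fun=> Z) 0); first by sigma00.
by move=> p u /= -> _; rewrite -[add _ _]/(pair _ _) ZP /= fst_pair.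
Qed.

Lemma arith_ind (P : D -> Prop) : Ar (fun w => P (w 0%N)) ->
  P 0 -> (forall n, P n -> P (n + 1)) -> forall n, P n.
Proof.
move=> /comprehension [Z ZP].
apply: (@sigma01_ind (Mem (Var 0) 0) (fun=> Z) 0 0); first by sigma00.
by move=> n u u0 _ _; rewrite -ZP -u0; split; [case | exists 0].
Qed.

Lemma arith_least (P : D -> Prop) : Ar (fun w => P (w 0%N)) ->
  (exists n, P n) -> exists n, P n /\ forall m, P m -> n <= m.
Proof.
move=> hP [n Pn]; apply: NNPP => no.
have h : forall k j, j <= k -> ~ P j.
  apply: arith_ind.
  -by have h := Ar_rel1 hP; ar; apply: h; ar.
  - by move=> j j0 Pj; apply: no; exists j; split=> // m _; apply: (le_trans j0 (le_0 m)).
  - move=> k IH j jk Pj; apply: no; exists j; split=> // m Pm.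
    apply: (le_trans jk); apply/ltS; case: (le_lt m k) => // /IH /(_ Pm) [].
exact: (h n n (le_refl n)).
Qed.

(** * Coding of finite sets *)

Definition dvd (p d : D) := exists q, d = p * q.

Lemma dvd_mulr p d e : dvd p d -> dvd p (d * e).
Proof. by move=> [q ->]; exists (q * e); ring. Qed.

Lemma dvd_add p a b : dvd p a -> dvd p b -> dvd p (a + b).
Proof. by move=> [q ->] [r ->]; exists (q + r); ring. Qed.

Lemma add_eq0 a b : a + b = 0 -> a = 0.
Proof.
by case: (zero_or_succ a) => [//|[k ->]]; rewrite addSn => /(succ_neq0 B).
Qed.

(** In place of a subtraction the two quotients are compared; if that of [a + b] is at most that of
    [b], then [a] is 0. *)
Lemma dvd_addl p a b : dvd p (a + b) -> dvd p b -> dvd p a.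
Proof.
move=> [u e] [v ev]; rewrite {}ev in e.
case: (le_total u v) => [[k ek]|[k ek]]; rewrite {}ek in e.
  suff -> : a = 0 by exists 0; ring.
  apply: (@add_eq0 a (p * k)); apply: (@addnI (p * u)).
  by rewrite add0n; apply: etrans e; ring.
by exists k; apply: (@addnI (p * v)); apply: (etrans e); ring.
Qed.

(* Bezout: if y < c and c - y divides m, then with p = 1+(y+1)m, q = 1+(c+1)m and
   m = (c-y)f one has (y+1)^2 f q + p = 1 + (y+1)(c+1) f p. *)
Lemma bezout m y c : (exists2 e, c = y + e & dvd e m) ->
  exists r t, r * (1 + (c + 1) * m) + (1 + (y + 1) * m) = 1 + t * (1 + (y + 1) * m).
Proof.
case=> e -> [f ->]; exists ((y + 1) * (y + 1) * f), ((y + 1) * f * (y + e + 1)). ring.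
Qed.

(** Gauss's lemma for the moduli of Goedel's beta function: the relation from [bezout] is multiplied
    by [d]. The two cases differ in which modulus is larger, since there are no negative numbers. *)
Lemma gauss m y c d : (exists2 e, c = y + e & dvd e m) \/ (exists2 e, y = c + e & dvd e m) ->
  dvd (1 + (y + 1) * m) (d * (1 + (c + 1) * m)) -> dvd (1 + (y + 1) * m) d.
Proof.
set p := 1 + (y + 1) * m; set q := 1 + (c + 1) * m.
case=> /bezout [r [t e]] h.
  apply: (@dvd_addl _ _ (p * (t * d))); last by exists (t * d).
  have -> : d + p * (t * d) = d * q * r + p * d.
    transitivity (d * (1 + t * p)); first by ring.
    by rewrite /p -e /q; ring.
  by apply: dvd_add; [apply: dvd_mulr | exists d].
apply: (@dvd_addl _ _ (d * q * t)); last exact: dvd_mulr.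
have -> : d + d * q * t = d * q + p * (r * d).
  transitivity (d * (1 + t * q)); first by ring.
  by rewrite /q -e /p; ring.
by apply: dvd_add => //; exists (r * d).
Qed.

(** The multiple is written [m + 1] to keep it nonzero; passing from [b] to [b + 1] multiplies it by
    [b + 1]. *)
Lemma common_multiple b : exists m, forall i, i < b -> dvd (i + 1) (m + 1).
Proof.
move: b; apply: arith_ind; first by rewrite /dvd; ar.
  by exists 0 => i /(lt_zero B).
move=> b [m hm]; exists (m * (b + 1) + b) => i /leS /le_lteq h.
have -> : m * (b + 1) + b + 1 = (m + 1) * (b + 1) by ring.
case: h => [/hm|->]; first exact: dvd_mulr.
by exists (m + 1); ring.
Qed.

(* [inF y s]: y belongs to the finite set coded by s = (b, (m, d)). *)
Definition inF (y s : D) :=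
  y < fst s /\ dvd (1 + (y + 1) * fst (snd s)) (snd (snd s)).

Lemma inF_lt y s : inF y s -> y < s.
Proof. by case=> h _; apply: (lt_le_trans h); case: (unpair_le s). Qed.

(** The code [d] is the product of the moduli 1 + (y + 1)(m + 1) over the members [y] of the set,
    built up to [c] by induction. Every positive number up to [b] divides [m + 1], so these moduli
    are pairwise coprime and no other one divides the product. *)
Lemma finite_comp (P : D -> Prop) b : Ar (fun w => P (w 0%N)) ->
  exists s, forall y, inF y s <-> y < b /\ P y.
Proof.
move=> hP; have [m hm] := common_multiple b.
have dm e : e <= b -> e <> 0 -> dvd e (m + 1).
  case: (zero_or_succ e) => [->//|[i ->]] /ltS ib _; exact: hm.
suff [d hd] : exists d, forall y, y < b -> (dvd (1 + (y + 1) * (m + 1)) d <-> y < b /\ P y).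
  exists (pair b (pair (m + 1) d)) => y; rewrite /inF !(fst_pair, snd_pair).
  by split=> [[yb /(hd _ yb)]|[yb Py]] //; split=> //; apply/hd.
suff : forall c, c <= b ->
    exists d, forall y, y < b -> (dvd (1 + (y + 1) * (m + 1)) d <-> y < c /\ P y).
  by apply; apply: le_refl.
apply: arith_ind; first by rewrite /dvd; have h := Ar_rel1 hP; ar; apply: h; ar.
  (* The empty product 1 has no modulus as a divisor, since each modulus exceeds 1. *)
  move=> _; exists 1 => y _; split; last by case=> /(lt_zero B).
  case=> q; case: (zero_or_succ q) => [->|[k ->]] e.
    by case: (succ_neq0 B (n := 0)); rewrite (add0n 1); apply: (etrans e); ring.
  case: (@lt_irr 1); apply/ltP.
  by exists (k + y + m + y * m + (y + 1) * (m + 1) * k); apply: (etrans e); ring.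
move=> c IH cb; have cb' : c < b by apply/ltS.
have [d hd] := IH (ltW cb'); case: (classic (P c)) => [Pc|nPc]; last first.
  exists d => y /hd ->; split=> -[h Py]; split=> //; first by apply/(lt_succ B); left.
  by case/(lt_succ B): h => // e; case: nPc; rewrite -e.
exists (d * (1 + (c + 1) * (m + 1))) => y yb.
case: (classic (y = c)) => [->|yc].
  split=> _; last by exists d; ring.
  by split=> //; exact: lt_succ_diag.
have -> : (y < c + 1 /\ P y) <-> (y < c /\ P y).
  by split=> -[h Py]; split=> //; [case/(lt_succ B): h | apply/(lt_succ B); left].
rewrite -hd //; split; last exact: dvd_mulr.
(* The distance between [y] and [c] is positive and at most [b], hence divides [m + 1], so the new
   factor can be cancelled. *)
apply: gauss; case: (lt_tri y c) => [lt|//|lt]; [left | right].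
  have [e ee] := ltW lt; exists e => //; apply: dm.
    by apply: le_trans (ltW cb'); rewrite ee; apply: le_addl.
  by move=> e0; apply: yc; rewrite ee e0; ring.
have [e ee] := ltW lt; exists e => //; apply: dm.
  by apply: le_trans (ltW yb); rewrite ee; apply: le_addl.
by move=> e0; apply: yc; rewrite ee e0; ring.
Qed.

Lemma Ar_inF t1 t2 : Fn t1 -> Fn t2 -> Ar (fun v => inF (t1 v) (t2 v)).
Proof. by move=> h1 h2; apply: (Ar_rel2 (R := inF)) => //; rewrite /inF /dvd; ar. Qed.

Ltac ar_finite ::= lazymatch goal with
  | |- Ar (fun _ => inF _ _) => apply Ar_inF
  end.

Lemma one_neq0 : 1 <> 0.
Proof. by rewrite -{1}(add0n 1); apply: (succ_neq0 B). Qed.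

Lemma rel_comp (R : D -> D -> Prop) : Ar (fun w => R (w 0%N) (w 1%N)) ->
  exists Z, forall a b, pair a b \in Z <-> R a b.
Proof.
move=> hR; have [|Z ZP] := @comprehension (fun z => R (fst z) (snd z)).
  by apply: (Ar_rel2 hR); ar.
by exists Z => a b; rewrite ZP fst_pair snd_pair.
Qed.

(** A finite subcover can be enlarged to all indices of [I] below a bound, so the quantifier over
    finite sets becomes a number quantifier. *)
Lemma compact_bound (X U : D -> Prop) : (forall i x, section U i x -> X x) ->
  compact X U <->
  forall I : sets M, covers X U I ->
    exists b, forall x, X x -> exists i, i < b /\ i \in I /\ section U i x.
Proof.
move=> UX; split=> h I cI.
  have [a [[b bP] aI ca]] := h I cI; exists b => x /ca [i [ia Ui]].
  by exists i; split; [apply: bP | split=> //; apply: aI].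
have [b bP] := h I cI; have [a aP] := restrict_ex I b; exists a; split.
- by exists b => i /aP [].
- by move=> i /aP [].
move=> x; split; last by case=> i [_ /UX].
by move=> /bP [i [ib [iI Ui]]]; exists i; split=> //; apply/aP.
Qed.

(** * The tree of choices of literals and its space *)

Section Choice_tree.

Variable L : sets M.

Definition tr (C : sets M) (v : D) :=
  exists c, v = pair c 1 /\ c \in C \/ v = pair c 0 /\ c \notin C.

(* A literal is [pair c 1] or [pair c 0]; clause m of the n-th problem contains the
   literals v with (n, (m, v)) in L. *)
Definition solvable (n : D) :=
  exists C, forall m, exists v, pair n (pair m v) \in L /\ tr C v.

Definition allowed (n m v : D) :=
  pair n (pair m v) \in L /\ exists c, v = pair c 1 \/ v = pair c 0.

(** A sequence is coded by its length together with a finite set of pairs (position, entry). Such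
    codes are not unique, so extension is expressed through entries, by [sub]. *)
Definition ent (x m v : D) := inF (pair m v) (snd x).

Definition node (n x : D) :=
  (forall m, m < fst x -> exists v, ent x m v) /\
  (forall m v, ent x m v -> m < fst x) /\
  (forall m v, ent x m v -> allowed n m v) /\
  (forall m v v', ent x m v -> ent x m v' -> v = v') /\
  (forall c m m', ent x m (pair c 1) -> ~ ent x m' (pair c 0)).

Definition sub (x y : D) := forall m v, ent x m v -> ent y m v.

(* The index i = (s, b) denotes the set of extensions of the sequence s whose entry
   at position |s|, if any, is at least b. *)
Definition bas (n i y : D) :=
  node n (fst i) /\ node n y /\ sub (fst i) y /\
  forall v, ent y (fst (fst i)) v -> snd i <= v.

Lemma node_total n x m : node n x -> m < fst x -> exists v, ent x m v.
Proof. by case=> h _; apply: h. Qed.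

Lemma node_dom n x m v : node n x -> ent x m v -> m < fst x.
Proof. by case=> _ [h _]; apply: h. Qed.

Lemma node_fun n x m v v' : node n x -> ent x m v -> ent x m v' -> v = v'.
Proof. by case=> _ [_ [_ [h _]]]; apply: h. Qed.

Lemma sub_trans y x z : sub x y -> sub y z -> sub x z.
Proof. by move=> h1 h2 m v /h1 /h2. Qed.

Lemma sub_below n x y m v : node n x -> node n y -> sub x y -> m < fst x ->
  ent y m v -> ent x m v.
Proof.
move=> nx ny xy /(node_total nx) [v' xv'] yv.
by rewrite (node_fun ny yv (xy _ _ xv')).
Qed.

Lemma sub_len n x y : node n x -> node n y -> sub x y -> fst x <= fst y.
Proof.
move=> nx ny xy; apply: nlt_le => lt.
by have [v /xy /(node_dom ny) /lt_irr] := node_total nx lt.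
Qed.

(** Both sequences are initial segments of [x], hence comparable. If that of [j] is longer, it
    already contains the entry that [i] restricts, and this entry is the one in [x]; at equal length
    the bounds decide. *)
Lemma bas_nested n i j x :
  bas n i x -> bas n j x ->
  fst (fst i) < fst (fst j) \/ fst (fst i) = fst (fst j) /\ snd i <= snd j ->
  forall y, bas n j y -> bas n i y.
Proof.
move=> [ni [nx [ix xi]]] [nj [_ [jx _]]] h y [_ [ny [jy yj]]].
have ij : sub (fst i) (fst j).
  move=> m v iv; apply: (sub_below nj nx jx) (ix _ _ iv).
  by case: h => [lt|[<- _]]; [apply: lt_trans lt|]; apply: (node_dom ni iv).
split=> //; split=> //; split; first exact: sub_trans jy.
case: h => [lt|[-> le]] v yv; last exact: le_trans (yj _ yv).
exact/xi/jx/(sub_below nj ny jy lt).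
Qed.

Lemma Ar_node n t : Fn n -> Fn t -> Ar (fun v => node (n v) (t v)).
Proof. by move=> hn ht; apply: (Ar_rel2 (R := node)) => //; rewrite /node /allowed /ent; ar. Qed.

Lemma Ar_sub t1 t2 : Fn t1 -> Fn t2 -> Ar (fun v => sub (t1 v) (t2 v)).
Proof. by move=> h1 h2; apply: (Ar_rel2 (R := sub)) => //; rewrite /sub /ent; ar. Qed.

Ltac ar_tree ::= lazymatch goal with
  | |- Ar (fun _ => ent _ _ _) => apply Ar_inF
  | |- Ar (fun _ => node _ _) => apply Ar_node
  | |- Ar (fun _ => sub _ _) => apply Ar_sub
  end.

Lemma Ar_bas n i t : Fn n -> Fn i -> Fn t -> Ar (fun v => bas (n v) (i v) (t v)).
Proof.
move=> hn hi ht; apply: (Ar_rel3 (R := bas)) => //; rewrite /bas; ar.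
Qed.

Ltac ar_bas ::= lazymatch goal with
  | |- Ar (fun _ => bas _ _ _) => apply Ar_bas
  end.

Lemma seq_comp (F : sets M) b :
  exists s, forall m v, inF (pair m v) s <-> pair m v < b /\ pair m v \in F.
Proof. by have [|s sP] := @finite_comp (fun y => y \in F) b; [ar | exists s => m v; apply: sP]. Qed.

Lemma restrict_node n x k : node n x -> k <= fst x ->
  exists y, [/\ node n y, fst y = k & forall m v, ent y m v <-> m < k /\ ent x m v].
Proof.
move=> nx kx.
have [|s sP] := @finite_comp (fun y => inF y (snd x) /\ fst y < k) (snd x); first by ar.
have eP m v : ent (pair k s) m v <-> m < k /\ ent x m v.
  rewrite /ent snd_pair sP fst_pair; split=> [[_ []]|[mk xv]] //.
  by split=> //; apply: inF_lt.
exists (pair k s); rewrite fst_pair; split=> //.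
split; first by move=> m; rewrite fst_pair => mk;
  have [v xv] := node_total nx (lt_le_trans mk kx); exists v; apply/eP.
split; first by move=> m v /eP []; rewrite fst_pair.
case: nx => _ [_ [h1 [h2 h3]]]; split; first by move=> m v /eP [_ /h1].
split; first by move=> m v v' /eP [_ h] /eP [_]; apply: h2 h.
by move=> c m m' /eP [_ h] /eP [_]; apply: h3 h.
Qed.

Lemma tr_pos C c : tr C (pair c 1) <-> c \in C.
Proof.
split; last by move=> h; exists c; left.
by case=> d [[/pair_inj [-> _] h]|[/pair_inj [_ /one_neq0]]].
Qed.

Lemma tr_neg C c : tr C (pair c 0) <-> c \notin C.
Proof.
split; last by move=> h; exists c; right.
by case=> d [[/pair_inj [_ /esym /one_neq0]]|[/pair_inj [-> _] h]].
Qed.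

Lemma tr_lit C v : tr C v -> exists c, v = pair c 1 \/ v = pair c 0.
Proof. by case=> c [[-> _]|[-> _]]; exists c; [left | right]. Qed.

(** * Solvability versus compactness *)

Definition bounded_compact (n : D) :=
  forall I : sets M, (forall x, node n x <-> exists i, i \in I /\ bas n i x) ->
    exists b, forall x, node n x -> exists i, i < b /\ i \in I /\ bas n i x.

(** The path [F] takes from each clause its least literal true under [C]. If indices below [b]
    sufficed for the cover that it defines, the initial segment [y] of [F] of length [b] would still
    be uncovered. *)
Lemma solvable_not_compact n : solvable n -> ~ bounded_compact n.
Proof.
case=> C hC' cn.
pose f m v := (pair n (pair m v) \in L /\ tr C v) /\
   forall v', pair n (pair m v') \in L /\ tr C v' -> v <= v'.
have [|F FP] := @rel_comp f; first by rewrite /f /tr; ar.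
have F_total m : exists v, pair m v \in F.
  have [||v [h1 h2]] := @arith_least (fun v => pair n (pair m v) \in L /\ tr C v).
  - by rewrite /tr; ar.
  - exact: hC'.
  - by exists v; apply/FP; split.
have F_fun m v v' : pair m v \in F -> pair m v' \in F -> v = v'.
  by move=> /FP [h1 h2] /FP [h1' h2']; apply: le_anti; [apply: h2 | apply: h2'].
pose good x := forall m v, ent x m v -> pair m v \in F.
have [|I IP] := @comprehension (fun i => node n (fst i) /\
  ((good (fst i) /\ exists v, pair (fst (fst i)) v \in F /\ snd i = v + 1) \/
   (~ good (fst i) /\ snd i = 0))); first by rewrite /good; ar.
have [x|b bP] := cn I.
  split; last by case=> i [_ [_ []]].
  move=> nx; have cov b : bas n (pair x b) x.
    rewrite /bas fst_pair snd_pair; split=> //; split=> //; split=> // v.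
    by move=> /(node_dom nx) /lt_irr.
  case: (classic (good x)) => gx.
    have [v Fv] := F_total (fst x); exists (pair x (v + 1)); split=> //; apply/IP.
    by rewrite fst_pair snd_pair; split=> //; left; split=> //; exists v.
  exists (pair x 0); split=> //; apply/IP.
  by rewrite fst_pair snd_pair; split=> //; right.
(* [B0] bounds the codes of the first [b] entries of the path, as [seq_comp] requires; [G] removes
   later entries whose codes may also lie below [B0]. *)
have [B0 BP] : exists B0, forall m v, m < b -> pair m v \in F -> pair m v < B0.
  move: b {bP}; apply: arith_ind; first by ar.
    by exists 0 => m v /(lt_zero B).
  move=> b [B0 BP]; have [v Fv] := F_total b; exists (B0 + (pair b v + 1)) => m v'.
  case/(lt_succ B) => [mb|->] h.
    exact: (lt_le_trans (BP _ _ mb h) (le_addr _ _)).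
  by rewrite (F_fun _ _ _ h Fv); apply: (lt_le_trans (lt_succ_diag _)); apply: le_addl.
have [|G GP] := @rel_comp (fun m v => pair m v \in F /\ m < b); first by ar.
have [s sP] := seq_comp G B0; pose y := pair b s.
have eP m v : ent y m v <-> m < b /\ pair m v \in F.
  rewrite /ent /y snd_pair sP GP; split; first by case=> _ [].
  by case=> mb h; split=> //; apply: BP.
have gy : good y by move=> m v /eP [].
have ny : node n y.
  split.
    by move=> m; rewrite /y fst_pair => mb; have [v Fv] := F_total m; exists v; apply/eP.
  split; first by move=> m v /eP []; rewrite /y fst_pair.
  split; first by move=> m v /gy /FP [[h1 h2] _]; split=> //; apply: tr_lit h2.
  split; first by move=> m v v' /gy h /gy; apply: F_fun h.
  move=> c m m' /gy /FP [[_ /tr_pos h] _] /gy /FP [[_ /tr_neg h'] _]; exact: h' h.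
have [i [ib [/IP [ni h] [_ [_ [iy iyb]]]]]] := bP y ny.
case: h => [[_ [v [Fv e]]]|[[]]]; last by move=> m v /iy /gy.
(* The sequence of [i] has length at most [i < b], so [y] has the entry [v] there, but [i] demands
   at least [v + 1]. *)
have /iyb : ent y (fst (fst i)) v.
  apply/eP; split=> //; apply: (le_lt_trans _ ib).
  by apply: (@le_trans (fst i)); [case: (unpair_le (fst i)) | case: (unpair_le i)].
by rewrite e => /le_nlt; apply; apply: lt_succ_diag.
Qed.

(** Fix a cover without finite subcover. The nodes whose cone is not finitely covered ([FC] fails)
    form a tree [S] without leaves; its leftmost path is infinite, and the positive literals on it
    define a solution. *)
Lemma not_compact_solvable n : ~ bounded_compact n -> solvable n.
Proof.
move=> nc; have [I cI noB] : exists2 I : sets M,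
    (forall x, node n x <-> exists i, i \in I /\ bas n i x) &
    ~ exists b, forall x, node n x -> exists i, i < b /\ i \in I /\ bas n i x.
  apply: NNPP => h; apply: nc => I cI; apply: NNPP => h'; apply: h; by exists I.
pose FC x := exists b, forall y, node n y -> sub x y -> exists i, i < b /\ i \in I /\ bas n i y.
have FC_mono x y : sub x y -> FC x -> FC y.
  by move=> xy [b bP]; exists b => z nz yz; apply: bP => //; apply: sub_trans yz.
have [|S SP] := @comprehension (fun x => node n x /\ ~ FC x); first by rewrite /FC; ar.
have [r rS r0] : exists2 r, r \in S & fst r = 0.
  have [|s sP] := @finite_comp (fun=> True) 0; first by ar.
  have no m v : ~ ent (pair 0 s) m v.
    by rewrite /ent snd_pair sP => -[/(lt_zero B)].
  exists (pair 0 s); last by rewrite fst_pair.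
  apply/SP; split.
    split; first by move=> m; rewrite fst_pair => /(lt_zero B).
    split; first by move=> m v /no.
    split; first by move=> m v /no.
    by split=> [m v v' /no|c m m' /no].
  by case=> b bP; apply: noB; exists b => x nx; apply: bP => // m v /no.
have step x : x \in S -> exists y, [/\ y \in S, sub x y & fst y = fst x + 1].
  move=> /SP [nx nFC]; apply: NNPP => no; apply: nFC.
  have [i [iI xi]] := (cI x).1 nx; have [ni [_ [ix ixb]]] := xi.
  (* If the sequence of [i] is shorter than [x], the entry that [i] restricts is already fixed by
     [x], so this one basic set contains the whole cone of [x]. *)
  case: (le_lteq (sub_len ni nx ix)) => [lt|len].
    exists (i + 1) => y ny xy; exists i; split; first exact: lt_succ_diag.
    split=> //; split=> //; split=> //; split; first exact: sub_trans xy.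
    by move=> v yv; apply: ixb; apply: (sub_below nx ny xy).
  (* Otherwise it misses only extensions of [x] with next entry below [snd i]; if no child is in
     [S], induction on [c] adds up the bounds for these finitely many cones. *)
  have claim : forall c, exists b, forall y v, node n y -> sub x y -> v < c ->
      ent y (fst x) v -> exists i, i < b /\ i \in I /\ bas n i y.
    apply: arith_ind; first by ar.
      by exists 0 => y v _ _ /(lt_zero B).
    move=> c [b bP].
    case: (classic (exists y, [/\ node n y, sub x y & ent y (fst x) c])); last first.
      move=> h; exists b => y v ny xy /(lt_succ B) [|->]; first exact: bP.
      by move=> yc; case: h; exists y.
    case=> y0 [ny0 xy0 y0c].
    have len0 := (ltS _ _).2 (node_dom ny0 y0c).
    have [z [nz lz zP]] := restrict_node ny0 len0.
    have xz : sub x z.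
      move=> m v xv; apply/zP; split; last exact: xy0.
      by apply: (lt_trans _ (lt_succ_diag _)); apply: (node_dom nx xv).
    have [b' bP'] : FC z.
      by apply: NNPP => h; apply: no; exists z; split=> //; apply/SP.
    exists (b + b') => y v ny xy /(lt_succ B) vc yv.
    case: vc => [lt|e].
      have [j [jb h]] := bP _ _ ny xy lt yv; exists j; split=> //.
      exact: lt_le_trans (le_addr _ _).
    rewrite {}e in yv; have [|j [jb h]] := bP' y ny.
      move=> m w /zP [/(lt_succ B) [lt|->] y0w]; last by rewrite (node_fun ny0 y0w y0c).
      by apply: xy; apply: (sub_below nx ny0 xy0).
    by exists j; split=> //; apply: lt_le_trans (le_addl _ _).
  have [b bP] := claim (snd i); exists (b + (i + 1)) => y ny xy.
  case: (classic (exists v, v < snd i /\ ent y (fst x) v)) => [[v [lt yv]]|h].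
    have [j [jb h]] := bP _ _ ny xy lt yv; exists j; split=> //.
    exact: lt_le_trans (le_addr _ _).
  exists i; split; first exact: (lt_le_trans (lt_succ_diag _) (le_addl _ _)).
  split=> //; split=> //; split=> //; split; first exact: sub_trans xy.
  by rewrite len => v yv; apply: nlt_le => lt; apply: h; exists v.
have S_node x : x \in S -> node n x by case/SP.
(* The leftmost path through S. *)
have [|P PP] := @comprehension (fun x => x \in S /\ forall m v, ent x m v ->
    forall y, y \in S -> (forall m' v', m' < m -> ent x m' v' -> ent y m' v') ->
    forall v', ent y m v' -> v <= v'); first by ar.
have P_node x : x \in P -> node n x by case/PP => /S_node.
have P_ext x : x \in P -> exists y, y \in P /\ fst y = fst x + 1.
  move=> /PP [xS xmin]; have nx := S_node _ xS.
  (* The next entry is the least [v] that continues [x] inside [S]; the node [y0] may be longer, so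
     it is cut to one entry more than [x], which stays in [S] by [FC_mono]. *)
  have [||v [[y0 [y0S [xy0 y0v]]] vmin]] := @arith_least
      (fun v => exists y, y \in S /\ sub x y /\ ent y (fst x) v).
  - by ar.
  - have [y [yS xy ly]] := step x xS.
    have [|v yv] := @node_total n y (fst x) (S_node _ yS).
      by rewrite ly; apply: lt_succ_diag.
    by exists v, y.
  have ny0 := S_node _ y0S; have len0 := (ltS _ _).2 (node_dom ny0 y0v).
  have [y [ny ly yP]] := restrict_node ny0 len0.
  exists y; split=> //; apply/PP; split.
    apply/SP; split=> //; have [_ h] := (SP y0).1 y0S; move=> /FC_mono; move/(_ y0) => h'.
    by apply/h/h' => m w /yP [].
  move=> m w /yP [/(lt_succ B) [lt|->] y0w] z zS agree.
    apply: (xmin m w); [exact: (sub_below nx ny0 xy0) | exact: zS|].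
    move=> m' v' m'm xv'; apply: agree => //; apply/yP; split; last exact: xy0.
    by apply: (lt_trans _ (lt_succ_diag _)); apply: (node_dom nx xv').
  move=> v' zv'; rewrite (node_fun ny0 y0w y0v); apply: vmin; exists z; split=> //; split=> //.
  move=> m' u xu; have lt := node_dom nx xu; apply: agree => //; apply/yP.
  by split; [apply: (lt_trans lt (lt_succ_diag _)) | apply: xy0].
have P_len : forall l, exists x, x \in P /\ fst x = l.
  apply: arith_ind; first by ar.
    exists r; split=> //; apply/PP; split=> // m v /(node_dom (S_node _ rS)).
    by rewrite r0 => /(lt_zero B).
  by move=> l [x [/P_ext [y [yP e]] <-]]; exists y.
(* When two members of [P] agree before position m, each competes in the minimality of the other at
   m, so their entries there coincide. *)
have agree x y : x \in P -> y \in P ->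
    forall k m v v', m < k -> ent x m v -> ent y m v' -> v = v'.
  move=> xP yP; have nx := P_node _ xP; have ny := P_node _ yP.
  have [[xS xmin] [yS ymin]] := ((PP x).1 xP, (PP y).1 yP).
  apply: arith_ind; first by ar.
    by move=> m v v' /(lt_zero B).
  move=> k IH m v v' /(lt_succ B) [|->]; first exact: IH.
  move=> xv yv'; apply: le_anti.
    apply: (xmin k v xv y) => // m' w m'k xw.
    have [w' yw'] := node_total ny (lt_trans m'k (node_dom ny yv')).
    by rewrite (IH _ _ _ m'k xw yw').
  apply: (ymin k v' yv' x) => // m' w m'k yw.
  have [w' xw'] := node_total nx (lt_trans m'k (node_dom nx xv)).
  by rewrite -(IH _ _ _ m'k xw' yw).
have [|C CP] := @comprehension (fun c => exists x, x \in P /\ exists m, ent x m (pair c 1)).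
  by ar.
exists C => m; have [x [xP lx]] := P_len (m + 1); have nx := P_node _ xP.
have [|v xv] := @node_total n x m nx; first by rewrite lx; apply: lt_succ_diag.
have [Lv [c hc]] : allowed n m v by case: nx => _ [_ [h _]]; apply: h.
exists v; split=> //; case: hc => hc; rewrite {}hc in xv Lv *.
  by apply/tr_pos/CP; exists x; split=> //; exists m.
apply/tr_neg => /CP [y [yP [m' yv]]]; have ny := P_node _ yP.
(* A member of [P] at least as long as both [x] and [y] contains the entries of both, and as a node
   it cannot hold [c] and its negation. *)
have [z [zP lz]] := P_len (fst x + fst y); have nz := P_node _ zP.
have ze x' k w : x' \in P -> ent x' k w -> k < fst z -> ent z k w.
  move=> xP' xw' kz; have [w' zw'] := node_total nz kz.
  by rewrite (agree x' z xP' zP (k + 1) k w w' (lt_succ_diag _)).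
have z0 : ent z m (pair c 0).
  apply: (ze x) => //; rewrite lz; apply: lt_le_trans (le_addr _ _).
  exact: (node_dom nx xv).
have z1 : ent z m' (pair c 1).
  apply: (ze y) => //; rewrite lz; apply: lt_le_trans (le_addl _ _).
  exact: (node_dom ny yv).
by case: nz => _ [_ [_ [_ h]]]; apply: h z1 z0.
Qed.

(** The hypothesis on compact indices is applied to the trees of all problems at once. For a point
    in two basic sets, [k] returns the index with the longer sequence or, at equal length, the
    larger bound; by [bas_nested] that set lies in the other. *)
Lemma unsolvable_set : set_exists (fun n => ~ solvable n).
Proof.
have [|X XP] := @rel_comp node; first by ar.
have [|U UP] := @comprehension (fun z => bas (fst z) (fst (snd z)) (snd (snd z))); first by ar.
have {}UP n i x : pair n (pair i x) \in U <-> bas n i x by rewrite UP !(fst_pair, snd_pair).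
pose below i j := fst (fst i) < fst (fst j) \/ fst (fst i) = fst (fst j) /\ snd i <= snd j.
have [|k kP] := @comprehension (fun z => exists n x i j m,
  z = pair n (quadruple x i j m) /\ node n x /\ (below i j /\ m = j \/ ~ below i j /\ m = i)).
  by rewrite /below /quadruple; ar.
have kX n q : pair n q \in k -> exists x i j m, node n x /\ q = quadruple x i j m.
  move=> /kP [n' [x [i [j [m [/pair_inj [-> ->] [nx _]]]]]]].
  by exists x, i, j, m.
have {}kP n x i j m : pair n (quadruple x i j m) \in k <->
    node n x /\ (below i j /\ m = j \/ ~ below i j /\ m = i).
  rewrite kP; split; last by move=> h; exists n, x, i, j, m.
  case=> n' [x' [i' [j' [m' [/pair_inj [-> /pair_inj [h ->]]]]]]].
  by move: h => /pair_inj [/pair_inj [-> ->] ->].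
have UX n i x : section (section (class_of U) n) i x -> section (class_of X) n x.
  by move=> /UP [_ [nx _]]; apply/XP.
have [Y YP] : set_exists (fun n => compact (section (class_of X) n) (section (class_of U) n)).
  apply: (hC (k := k)) => n; split.
  - exact: UX.
  - move=> x /XP nx; exists (pair x 0); apply/UP; rewrite /bas fst_pair snd_pair.
    by split=> //; split=> //; split=> // v _; apply: le_0.
  - split.
      move=> z /kX [x [i [j [m [/XP Xx ->]]]]].
      by exists x, i, j, m.
    by move=> x i j m m' /kP [_ h] /kP [_]; case: h => -[h ->] [[h' ->]|[h' ->]].
  - move=> x i j /UP xi /UP xj; have nx : node n x by case: xi => _ [].
    case: (classic (below i j)) => h.
      exists j; split; [by apply/kP; split=> //; left | exact/UP|].
      by move=> y /UP yj; split; apply/UP => //; apply: (bas_nested xi xj).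
    exists i; split; [by apply/kP; split=> //; right | exact/UP|].
    move=> y /UP yi; split; apply/UP => //; apply: (bas_nested xj xi) => //.
    case: (lt_tri (fst (fst j)) (fst (fst i))) => [|e|lt]; first by left.
      right; split=> //; apply/ltW; case: (le_lt (snd i) (snd j)) => // le.
      by case: h; right.
    by case: h; left.
exists Y => n; rewrite YP compact_bound; last exact: UX.
have -> : (forall I, covers (section (class_of X) n) (section (class_of U) n) I ->
    exists b, forall x, section (class_of X) n x ->
      exists i, i < b /\ i \in I /\ section (section (class_of U) n) i x) <->
    bounded_compact n; last first.
  split; first by move=> h /solvable_not_compact; apply.
  by move=> h; apply: NNPP => /not_compact_solvable.
split=> h I cI.
  have [|b bP] := h I.
    move=> x; split; first by move=> /XP /cI [i [iI /UP]]; exists i.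
    by case=> i [iI xi]; apply/XP/cI; exists i; split=> //; apply/UP.
  by exists b => x /XP /bP [i [ib [iI /UP]]]; exists i.
have [|b bP] := h I.
  move=> x; split; first by move=> /XP /cI [i [iI xi]]; exists i; split=> //; apply/UP.
  by case=> i [iI /UP xi]; apply/XP/cI; exists i.
by exists b => x /XP /bP [i [ib [iI xi]]]; exists i; split=> //; split=> //; apply/UP.
Qed.

End Choice_tree.

(** * Truth conditions as clauses *)

Definition satisfies (C : sets M) (K : D -> D -> Prop) :=
  forall m, exists lit, K m lit /\ tr C lit.

Definition join (K1 K2 : D -> D -> Prop) (m lit : D) :=
  fst m = 0 /\ K1 (snd m) lit \/ fst m <> 0 /\ K2 (snd m) lit.

Definition clause (l1 l2 : D -> D) (m lit : D) := lit = l1 m \/ lit = l2 m.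

Definition Ar2 (K : D -> D -> Prop) := Ar (fun w => K (w 0%N) (w 1%N)).

Definition Fn1 (h : D -> D) := Fn (fun w => h (w 0%N)).

Lemma Fn_app h t : Fn1 h -> Fn t -> Fn (fun w => h (t w)).
Proof.
move=> hh; apply: Fn_op1.
by apply: (@Ar_rel2 (fun a b => a = h b)); [exact: hh | ar | ar].
Qed.

Lemma satisfies_join C K1 K2 : satisfies C (join K1 K2) <-> satisfies C K1 /\ satisfies C K2.
Proof.
split=> [h|[h1 h2] m].
  split=> m; [have [l [[[]|[]] ]] := h (pair 0 m) | have [l [[[]|[]] ]] := h (pair 1 m)];
    rewrite fst_pair ?snd_pair //.
  - by move=> _ h1 h2; exists l.
  - by move=> /one_neq0.
  - by move=> _ h1 h2; exists l.
case: (classic (fst m = 0)) => m0.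
  by have [l [h h']] := h1 (snd m); exists l; split=> //; left.
by have [l [h h']] := h2 (snd m); exists l; split=> //; right.
Qed.

Lemma Ar2_join K1 K2 : Ar2 K1 -> Ar2 K2 -> Ar2 (join K1 K2).
Proof.
move=> h1 h2; rewrite /Ar2 /join; ar.
  by apply: (Ar_rel2 h1); ar.
by apply: (Ar_rel2 h2); ar.
Qed.

Lemma satisfies_clause C l1 l2 :
  satisfies C (clause l1 l2) <-> forall m, tr C (l1 m) \/ tr C (l2 m).
Proof.
split=> h m; first by have [l [[]-> h']] := h m; [left | right].
by case: (h m) => h'; [exists (l1 m) | exists (l2 m)]; split=> //; [left | right].
Qed.

Lemma Ar2_clause l1 l2 : Fn1 l1 -> Fn1 l2 -> Ar2 (clause l1 l2).
Proof. by move=> h1 h2; rewrite /Ar2 /clause; ar; apply: Fn_app => //; ar. Qed.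

(** * Columns of an assignment and the encoding of formulas *)

Fixpoint num (i : nat) : D := if i is j.+1 then num j + 1 else 0.

Lemma num_inj i j : num i = num j -> i = j.
Proof.
elim: i j => [|i IH] [|j] //=; first by move=> /esym /(succ_neq0 B).
  by move=> /(succ_neq0 B).
by move=> /(succ_inj B) /IH ->.
Qed.

(** The literals asserting and denying that [e] belongs to column [i]; the column number is a
    standard numeral. *)
Definition pos i e := pair (pair (num i) e) 1.
Definition neg i e := pair (pair (num i) e) 0.

Lemma Fn_pos i t : Fn t -> Fn (fun v => pos i (t v)).
Proof. by move=> h; rewrite /pos; ar. Qed.

Lemma Fn_neg i t : Fn t -> Fn (fun v => neg i (t v)).
Proof. by move=> h; rewrite /neg; ar. Qed.

Definition column (C : sets M) (i : nat) (e : D) := pair (num i) e \in C.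

Lemma tr_posE C i e : tr C (pos i e) <-> column C i e.
Proof. exact: tr_pos. Qed.

Lemma tr_negE C i e : tr C (neg i e) <-> ~ column C i e.
Proof. exact: tr_neg. Qed.

(* Tseitin encoding: given the set A in column 0, the clauses K force column i to be
   the truth set of Phi(-, A); T is the assignment of the auxiliary columns i..j-1. *)
Definition encodable (Phi : D -> sets M -> Prop) :=
  (forall A, Ar (fun w => Phi (w 0%N) A)) /\
  forall i, (0 < i)%N -> exists j K, [/\ (i < j)%N, Ar2 K,
    forall A C, (forall c, column C 0 c <-> c \in A) -> satisfies C K ->
      forall e, column C i e <-> Phi e A &
    forall A, exists T : nat -> D -> Prop,
      (forall l, Ar (fun w => T l (w 0%N))) /\
      forall C, (forall c, column C 0 c <-> c \in A) ->
        (forall l e, (i <= l < j)%N -> (column C l e <-> T l e)) -> satisfies C K].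

Lemma encodable_ext Phi Psi : (forall e A, Phi e A <-> Psi e A) ->
  encodable Phi -> encodable Psi.
Proof.
move=> h [h1 h2]; split; first by move=> A; apply: Ar_iff (h1 A).
move=> i /h2 [j [K [ij hK a b]]]; exists j, K; split=> // A C c0 CK e.
by rewrite (a A C) // h.
Qed.

Lemma encodable_const (Psi : D -> Prop) : Ar (fun w => Psi (w 0%N)) ->
  encodable (fun e _ => Psi e).
Proof.
move=> hP; split=> // i i0.
exists i.+1, (fun m lit => (Psi m /\ lit = pos i m) \/ (~ Psi m /\ lit = neg i m)).
have hP' := Ar_rel1 hP; split=> //.
- by rewrite /Ar2 /pos /neg; ar; apply: hP'; ar.
- move=> A C _ CK e; have [l [[[Pe ->]|[Pe ->]]]] := CK e; first by rewrite tr_posE.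
  by rewrite tr_negE.
move=> A; exists (fun=> Psi); split=> // C _ h m.
have {}h := h i m _; case: (classic (Psi m)) => Pm.
  by exists (pos i m); split; [left | apply/tr_posE/h; rewrite ?leqnn ?ltnSn].
by exists (neg i m); split; [right | apply/tr_negE; rewrite h ?leqnn ?ltnSn].
Qed.

Lemma encodable_mem t : Fn1 t -> encodable (fun e A => t e \in A).
Proof.
move=> ht; have arA A : Ar (fun w => t (w 0%N) \in A) by ar; apply: ht.
split=> // i i0.
exists i.+1, (join (clause (neg i) (fun m => pos 0 (t m))) (clause (pos i) (fun m => neg 0 (t m)))).
split=> //.
- apply: Ar2_join; apply: Ar2_clause; rewrite /Fn1.
  + by apply: Fn_neg; ar.
  + by apply: Fn_pos; apply: ht.
  + by apply: Fn_pos; ar.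
  + by apply: Fn_neg; apply: ht.
- move=> A C c0 /satisfies_join [/satisfies_clause h1 /satisfies_clause h2] e.
  move: (h1 e) (h2 e); rewrite !tr_posE !tr_negE c0; tauto.
move=> A; exists (fun _ e => t e \in A); split=> // C c0 h.
have {}h e : column C i e <-> t e \in A by apply: h; rewrite leqnn /=.
apply/satisfies_join; split; apply/satisfies_clause => m; rewrite tr_posE tr_negE c0 h; tauto.
Qed.

Lemma Ar_case (b : bool) P Q : Ar P -> Ar Q -> Ar (fun v => if b then P v else Q v).
Proof. by case: b. Qed.

(** Column [i] receives the result and the columns from [i.+1] on encode [Phi]; the two clauses per
    element make columns [i] and [i.+1] complementary. *)
Lemma encodable_not Phi : encodable Phi -> encodable (fun e A => ~ Phi e A).
Proof.
case=> arP hP; split=> [A|i i0]; first exact: Ar_not.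
have [j [K [ij arK a b]]] := hP i.+1 isT.
exists j, (join K (join (clause (neg i) (neg i.+1)) (clause (pos i) (pos i.+1)))).
split; first exact: ltn_trans ij.
- by do 2 apply: Ar2_join => //; apply: Ar2_clause; rewrite /Fn1;
    first [apply: Fn_neg | apply: Fn_pos]; ar.
- move=> A C c0 /satisfies_join [/(a A C c0) hC1] /satisfies_join.
  move=> [/satisfies_clause h1 /satisfies_clause h2] e.
  move: (h1 e) (h2 e); rewrite !tr_posE !tr_negE hC1; tauto.
move=> A; have [T [arT TP]] := b A.
exists (fun l e => if l == i then ~ Phi e A else T l e); split.
  by move=> l; apply: Ar_case; [apply: Ar_not|].
move=> C c0 h.
have CK : satisfies C K.
  apply: TP => // l e /andP [il lj]; rewrite h ?(ltnW il) //.
  by rewrite gtn_eqF.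
have h1 e : column C i e <-> ~ Phi e A by rewrite h ?leqnn ?(ltn_trans _ ij) // eqxx.
have h2 := a A C c0 CK.
apply/satisfies_join; split=> //; apply/satisfies_join; split; apply/satisfies_clause => m.
  by rewrite !tr_negE h1 h2; tauto.
by rewrite !tr_posE h1 h2; case: (classic (Phi m A)); tauto.
Qed.

(** [Phi] occupies the columns from [i.+1], [Psi] those from [j]. The clauses [K0] give one
    implication of the equivalence for column [i], the two binary families the other. *)
Lemma encodable_or Phi Psi : encodable Phi -> encodable Psi ->
  encodable (fun e A => Phi e A \/ Psi e A).
Proof.
move=> [arP hP] [arQ hQ]; split=> [A|i i0]; first exact: Ar_or.
have [j [K [ij arK a b]]] := hP i.+1 isT.
have [j' [K' [ij' arK' a' b']]] := hQ j (leq_ltn_trans (leq0n _) ij).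
pose K0 m lit := lit = neg i m \/ lit = pos i.+1 m \/ lit = pos j m.
exists j', (join (join K K') (join K0 (join (clause (pos i) (neg i.+1)) (clause (pos i) (neg j))))).
split; first by rewrite (ltn_trans _ ij') // (ltn_trans _ ij).
- apply: Ar2_join; first exact: Ar2_join.
  apply: Ar2_join; first by rewrite /Ar2 /K0 /pos /neg; ar.
  by apply: Ar2_join; apply: Ar2_clause; rewrite /Fn1;
    first [apply: Fn_neg | apply: Fn_pos]; ar.
- move=> A C c0 /satisfies_join [/satisfies_join [/(a A C c0) hC1 /(a' A C c0) hC2]].
  move=> /satisfies_join [h0 /satisfies_join [/satisfies_clause h1 /satisfies_clause h2]] e.
  have [l [K0l trl]] := h0 e.
  move: (h1 e) (h2 e); rewrite !tr_posE !tr_negE hC1 hC2.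
  by case: K0l trl => [->|[]->]; rewrite ?tr_posE ?tr_negE ?hC1 ?hC2; tauto.
move=> A; have [T [arT TP]] := b A; have [T' [arT' TP']] := b' A.
exists (fun l e => if l == i then Phi e A \/ Psi e A else if (l < j)%N then T l e else T' l e).
split; first by move=> l; apply: Ar_case; [apply: Ar_or|apply: Ar_case].
move=> C c0 h.
have CK : satisfies C K.
  apply: TP => // l e /andP [il lj]; rewrite h; last by rewrite (ltnW il) (ltn_trans lj).
  by rewrite gtn_eqF // lj.
have CK' : satisfies C K'.
  have ltij : (i < j)%N by apply: ltn_trans ij.
  apply: TP' => // l e /andP [jl lj']; rewrite h; last by rewrite (leq_trans (ltnW ltij)).
  by rewrite gtn_eqF ?(leq_trans ltij) // ltnNge jl.
have h0 e : column C i e <-> Phi e A \/ Psi e A.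
  by rewrite h ?eqxx // leqnn (ltn_trans _ ij') // (ltn_trans _ ij).
have h1 := a A C c0 CK; have h2 := a' A C c0 CK'.
apply/satisfies_join; split; first exact/satisfies_join.
apply/satisfies_join; split; last first.
  by apply/satisfies_join; split; apply/satisfies_clause => m;
    rewrite tr_posE tr_negE ?h0 ?h1 ?h2; tauto.
move=> m; case: (classic (Phi m A)) => P1.
  by exists (pos i.+1 m); split; [right; left | apply/tr_posE/h1].
case: (classic (Psi m A)) => P2.
  by exists (pos j m); split; [right; right | apply/tr_posE/h2].
by exists (neg i m); split; [left | apply/tr_negE; rewrite h0; tauto].
Qed.

(** This is where infinite clauses arise: membership of m in column [i] requires some [pair c m] in
    column [i.+1]. The converse clauses are indexed by pairs, read as [pair (fst m) (snd m)] because
    m itself need not be a pair. *)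
Lemma encodable_ex Phi : encodable Phi -> encodable (fun e A => exists a, Phi (pair a e) A).
Proof.
case=> arP hP; have arE A : Ar (fun w => exists a, Phi (pair a (w 0%N)) A).
  by ar; apply: (@Ar_rel1 (Phi^~ A)) => //; ar.
split=> // i i0; have [j [K [ij arK a b]]] := hP i.+1 isT.
pose K0 m lit := lit = neg i m \/ exists c, lit = pos i.+1 (pair c m).
exists j, (join K (join K0 (clause (pos i \o snd) (fun m => neg i.+1 (pair (fst m) (snd m)))))).
split; first exact: ltn_trans ij.
- apply: Ar2_join => //; apply: Ar2_join; first by rewrite /Ar2 /K0 /pos /neg; ar.
  by apply: Ar2_clause; rewrite /Fn1 /pos /neg /=; ar.
- move=> A C c0 /satisfies_join [/(a A C c0) hC1] /satisfies_join [h0 /satisfies_clause h1] e.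
  split.
    have [l [[->|[c ->]]]] := h0 e; first by rewrite tr_negE; tauto.
    by rewrite tr_posE hC1 => h _; exists c.
  case=> c; have := h1 (pair c e).
  by rewrite /= !(fst_pair, snd_pair) tr_posE tr_negE hC1; tauto.
move=> A; have [T [arT TP]] := b A.
exists (fun l e => if l == i then exists a, Phi (pair a e) A else T l e); split.
  by move=> l; apply: Ar_case.
move=> C c0 h.
have CK : satisfies C K.
  apply: TP => // l e /andP [il lj]; rewrite h ?(ltnW il) //.
  by rewrite gtn_eqF.
have h1 e : column C i e <-> exists a, Phi (pair a e) A.
  by rewrite h ?leqnn ?(ltn_trans _ ij) // eqxx.
have h2 := a A C c0 CK.
apply/satisfies_join; split=> //; apply/satisfies_join; split.
  move=> m; case: (classic (exists a, Phi (pair a m) A)) => [[c Pc]|no].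
    by exists (pos i.+1 (pair c m)); split; [right; exists c | apply/tr_posE/h2].
  by exists (neg i m); split; [left | apply/tr_negE; rewrite h1].
apply/satisfies_clause => m; rewrite /= tr_posE tr_negE h1 h2.
case: (classic (Phi (pair (fst m) (snd m)) A)); last by right.
by left; exists (fst m).
Qed.

Lemma Fn_eval (T : nat -> D -> D) t : (forall i, Fn1 (T i)) -> Fn1 (fun e => eval (T^~ e) t).
Proof.
move=> hT; rewrite /Fn1; elim: t => [i|||t1 h1 t2 h2|t1 h1 t2 h2] /=; ar.
exact: hT.
Qed.

(* [T i e] is the value that the stack e gives to the number variable i. *)
Lemma encodable_sat (s : nat -> sets M) X g : arithmetical g ->
  forall T : nat -> D -> D, (forall i, Fn1 (T i)) ->
  encodable (fun e A => sat (T^~ e) (update s X A) g).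
Proof.
have ex_case (f : formula) x (T : nat -> D -> D) :
    (forall T : nat -> D -> D, (forall i, Fn1 (T i)) ->
      encodable (fun e A => sat (T^~ e) (update s X A) f)) ->
    (forall i, Fn1 (T i)) ->
    encodable (fun e A => exists a, sat (update (T^~ e) x a) (update s X A) f).
  move=> IH hT.
  (* The quantified value is pushed on the stack [e]: variable [x] reads its top, the other
     variables read the rest. *)
  pose T' i e := if i == x then fst e else T i (snd e).
  have hT' i : Fn1 (T' i).
    rewrite /Fn1 /T'; case: eqP => _; first by ar.
    by apply: Fn_app => //; ar.
  apply: encodable_ext (encodable_ex (IH T' hT')) => e A.
  have E a : (fun i => T' i (pair a e)) = update (T^~ e) x a.
    apply: functional_extensionality => i; rewrite /T' /update.
    by rewrite fst_pair snd_pair.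
  by split=> -[a h]; exists a; move: h; rewrite E.
elim: g => //=.
- move=> t1 t2 _ T hT; apply: encodable_const.
  by apply: Ar_eq; apply: Fn_eval.
- move=> t1 t2 _ T hT; apply: encodable_const.
  by apply: Ar_lt; apply: Fn_eval.
- move=> t Y _ T hT; rewrite /update; case: (Y == X).
    by apply: encodable_mem; apply: Fn_eval.
  by apply: encodable_const; apply: Ar_mem; apply: Fn_eval.
- by move=> f IH af T hT; apply: encodable_not; apply: IH.
- move=> f IHf g IHg /andP [af ag] T hT.
  have := encodable_not (encodable_or (encodable_not (IHf af T hT)) (encodable_not (IHg ag T hT))).
  by apply: encodable_ext => e A; tauto.
- by move=> f IHf g IHg /andP [af ag] T hT; apply: encodable_or; [apply: IHf | apply: IHg].
- move=> f IHf g IHg /andP [af ag] T hT.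
  have := encodable_or (encodable_not (IHf af T hT)) (IHg ag T hT).
  by apply: encodable_ext => e A; tauto.
- move=> x f IH af T hT.
  have := encodable_not (ex_case (Not f) x T (fun T hT => encodable_not (IH af T hT)) hT).
  apply: encodable_ext => e A /=; split; last by move=> h [a]; apply.
  by move=> h a; apply: NNPP => h'; apply: h; exists a.
- by move=> x f IH af T hT; apply: ex_case => //; apply: IH.
Qed.

(** Columns are added one at a time by an induction on [j] outside the model, so each step is a
    single comprehension. *)
Lemma column_comp (A : sets M) (T : nat -> D -> Prop) j :
  (forall l, Ar (fun w => T l (w 0%N))) ->
  exists C, (forall c, column C 0 c <-> c \in A) /\
    forall l e, (0 < l < j)%N -> (column C l e <-> T l e).
Proof.
move=> arT; elim: j => [|j [C [C0 CT]]].
  have [|C CP] := @comprehension (fun z => fst z = 0 /\ snd z \in A); first by ar.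
  exists C; split; last by move=> l e; rewrite ltn0 andbF.
  by move=> c; rewrite /column CP fst_pair snd_pair /=; tauto.
case: j CT => [|j] CT; first by exists C; split=> // -[|[]].
have [|C' CP] := @comprehension (fun z => fst z = num j.+1 /\ T j.+1 (snd z) \/
    fst z <> num j.+1 /\ z \in C).
  by ar; apply: (Ar_rel1 (arT _)); ar.
have E l e : column C' l e <-> if l == j.+1 then T l e else column C l e.
  rewrite /column CP fst_pair snd_pair; case: eqP => [->|ne]; first by tauto.
  by split=> [[[/num_inj /ne]|[]]|h] //; right; split=> // /num_inj.
exists C'; split; first by move=> c; rewrite E /=.
move=> l e /andP [l0]; rewrite E ltnS leq_eqVlt; case: eqP => //= _ lj.
by apply: CT; rewrite l0.
Qed.

(** The n-th theory encodes the negation of [Phi] in column 1 and adds the unit clause [pos 1 n];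
    its solutions are assignments whose column 0 is a counterexample [A]. *)
Lemma encodable_comp Phi : encodable Phi -> set_exists (fun n => forall A, Phi n A).
Proof.
move=> /encodable_not [_ /(_ 1%N isT) [j [K [j1 arK a b]]]].
have [|L LP] := @comprehension (fun z => let m := fst (snd z) in let lit := snd (snd z) in
  fst m = 0 /\ lit = pos 1 (fst z) \/ fst m <> 0 /\ K (snd m) lit).
  by rewrite /pos; ar; apply: (Ar_rel2 arK); ar.
have {}LP n m lit : pair n (pair m lit) \in L <->
    fst m = 0 /\ lit = pos 1 n \/ fst m <> 0 /\ K (snd m) lit.
  by rewrite LP !(fst_pair, snd_pair).
have [Z ZP] := unsolvable_set L; exists Z => n; rewrite ZP; split.
  (* A counterexample [A] together with the truth sets [T] of the auxiliary columns solves the n-th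
     theory. *)
  move=> h A; apply: NNPP => nP; apply: h.
  have [T [arT TP]] := b A; have [C [C0 CT]] := column_comp A j arT.
  have CK : satisfies C K by apply: TP.
  exists C => m; case: (classic (fst m = 0)) => m0.
    exists (pos 1 n); split; first by apply/LP; left.
    by apply/tr_posE/(a A C).
  by have [l [Kl trl]] := CK (snd m); exists l; split=> //; apply/LP; right.
move=> h [C CL].
have [|A AP] := @comprehension (fun c => column C 0 c); first by rewrite /column; ar.
have CK : satisfies C K.
  move=> m; have [l [/LP]] := CL (pair 1 m); rewrite fst_pair snd_pair => h' trl.
  by exists l; case: h' => -[] // /one_neq0.
have [l [/LP]] := CL (pair 0 0); rewrite fst_pair => -[[_ ->]|[] //].
by move=> /tr_posE /(a A C) []//; move=> c; rewrite AP.
Qed.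

Lemma compact_indices_Pi11_comp : Pi11_comprehension M.
Proof.
move=> f x v s [X [g [ag ->]]] /=.
pose T i n := if i == x then n else v i.
have hT i : Fn1 (T i) by rewrite /Fn1 /T; case: eqP => _; ar.
exact: encodable_comp (encodable_sat s X ag hT).
Qed.

End Model.

(** * Compactness as a Pi^1_1 condition, and the equivalence *)

Lemma Pi11_comp_compact_indices (M : L2_structure) (hM : RCA0 M) :
  Pi11_comprehension M -> compact_indices_exist M.
Proof.
move=> comp X U k seq.
(* Number variables: 0 is the index j, 1 the bound, 2 the point, 3 the index of a basic set. Set
   variables: 0 is [X], 1 is [U], 2 the cover. The formula [f] is the criterion of
   [compact_bound]. *)
pose inX := Mem (pairT (Var 0) (Var 2)) 0.
pose inU := Mem (pairT (Var 0) (pairT (Var 3) (Var 2))) 1.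
pose cov := Ex 3 (And (Mem (Var 3) 2) inU).
pose fin := Ex 1 (All 2 (Imp inX (Ex 3 (And (Lt (Var 3) (Var 1)) (And (Mem (Var 3) 2) inU))))).
pose f := AllS 2 (Imp (All 2 (And (Imp inX cov) (Imp cov inX))) fin).
pose s i := if i is 0 then X else U.
have [|Z ZP] := comp f 0 (fun=> zero) s.
  by exists 2, (Imp (All 2 (And (Imp inX cov) (Imp cov inX))) fin).
exists Z => j; rewrite ZP (compact_bound hM); last first.
  by move=> i x; case: (seq j) => h _ _ _; apply: h.
exact: iff_refl.
Qed.

Theorem proposition6p18 (M : L2_structure) (hM : RCA0 M) :
  Pi11_comprehension M <-> compact_indices_exist M.
Proof.
split; first exact: Pi11_comp_compact_indices.
exact: compact_indices_Pi11_comp.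
Qed.
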